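(* Let $d\ge 4$ be an integer and suppose that $p\in[0,1]$ satisfies the conditions 1. $p<1-\left(\frac1d\right)^{\frac{1}{2d-1}}$, and 2. $\displaystyle \frac{1}{1-p}\left(p_2-\frac{1}{d^2}+\frac1d\left(1-\frac1d\right)\left(d(1-p)^{2d-1}-1\right)^{-1}\right)<1.$ Then $p_{shield}(d)\ge p$.
   Context: Let $\mathcal{E}^d$ be the set of nearest-neighbor edges of $\mathbb{Z}^d$. For $p\in[0,1]$, $\mathbb{P}_p$ is the product measure on $\{0,1\}^{\mathcal{E}^d}$ under which each edge $e$ is independently open ($\omega(e)=1$) with probability $p$ and closed ($\omega(e)=0$) with probability $1-p$. A path is an alternating sequence of vertices and edges $v_0,e_0,v_1,e_1,\dots$ in which $e_i\in\mathcal{E}^d$ has endpoints $v_i$ and $v_{i+1}$. A vertex $x\in\mathbb{Z}^d$ is shielded if all $2d$ edges incident to $x$ are closed. A shielded path is a path all of whose vertices are shielded; an infinite shielded path is understood to be an infinite vertex self-avoiding one (vertices $v_0,v_1,v_2,\dots$ all distinct). Define $$p_{shield}(d)=\sup\{p\in[0,1]:\mathbb{P}_p(\text{there exists an infinite shielded path})>0\}.$$ Let $\mathbf{e}_i$ be the $i$-th standard basis vector of $\mathbb{Z}^d$, and let $(X_n)_{n\ge1}$ and $(X_n')_{n\ge1}$ be two independent i.i.d. sequences with $\mathbb{P}(X_n=\mathbf{e}_i)=\mathbb{P}(X_n'=\mathbf{e}_i)=\frac1d$ for $1\le i\le d$. Put $S_0=S_0'=0$, $S_n=X_1+\dots+X_n$,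 $S_n'=X_1'+\dots+X_n'$, and $$p_2=\mathbb{P}\left(\|S_n-S_n'\|_1=2\text{ for some }n\ge2\,\middle|\,\|S_1-S_1'\|_1=2\right).$$ *)

(* Defs.v *)
From HB Require Import structures.
From mathcomp Require Import all_boot all_order all_algebra.
From mathcomp Require Import all_classical all_reals all_analysis.
From mathcomp Require Import measurable_realfun.
From mathcomp Require Import ring lra zify.

Set Implicit Arguments.
Unset Strict Implicit.
Unset Printing Implicit Defensive.

Import Order.TTheory GRing.Theory Num.Theory.
Import numFieldNormedType.Exports.
Local Open Scope classical_set_scope.
Local Open Scope ring_scope.

Section Probability.
Context {d : measure_display} {T : measurableType d} {R : realType}.
Variable P : probability T R.

(* [V] is meant to be countable, with all its subsets measurable. *)
Definition discrete_random_element (V : Type) (Y : T -> V) : Prop :=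
  forall A : set V, measurable (Y @^-1` A).

Definition mutually_independent (I : eqType) (V : Type) (Y : I -> T -> V) :
    Prop :=
  forall (s : seq I) (A : I -> set V), uniq s ->
    P [set t | forall i, i \in s -> A i (Y i t)] =
    (\prod_(i <- s) fine (P (Y i @^-1` A i)))%:E.

Definition cond_prob (A B : set T) : R := fine (P (A `&` B)) / fine (P B).

End Probability.

Definition lattice (d : nat) := 'rV[int]_d.

Definition unit_vec (d : nat) (i : 'I_d) : lattice d := delta_mx ord0 i.

Definition l1 (d : nat) (x : lattice d) : nat := (\sum_(i < d) `|x ord0 i|)%N.

(* The pair [(x, i)] stands for the unoriented edge {x, x + e_i}; every
   nearest-neighbor edge of Z^d is of this form for exactly one pair
   ([nearest_neighborP], [joins_inj]). *)
Definition edge (d : nat) : Type := (lattice d * 'I_d)%type.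

Definition joins (d : nat) (e : edge d) (x y : lattice d) : Prop :=
  (x = e.1 /\ y = e.1 + unit_vec e.2) \/ (y = e.1 /\ x = e.1 + unit_vec e.2).

Lemma l1_unit_vec (d : nat) (i : 'I_d) : l1 (unit_vec i) = 1%N.
Proof.
rewrite /l1 (bigD1 i) //= big1 => [|j ji]; rewrite mxE !eqxx ?addn0 //=.
by rewrite (negbTE ji).
Qed.
Lemma l1N (d : nat) (z : lattice d) : l1 (- z) = l1 z.
Proof. by apply: eq_bigr => i _; rewrite mxE abszN. Qed.

Lemma nearest_neighborP (d : nat) (x y : lattice d) :
  (exists e : edge d, joins e x y) <-> l1 (x - y) = 1%N.
Proof.
split.
  move=> [[z i] [] [-> ->]] /=.
    by rewrite opprD addNKr l1N l1_unit_vec.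
  by rewrite addrC addKr l1_unit_vec.
move=> /eqP /sum_nat_eq1[i [_ zi z0]].
have zj j : j != i -> (x - y) ord0 j = 0.
  by move=> ji; apply/eqP; rewrite -absz_eq0; apply/eqP; exact: z0.
have [e|e] : (x - y) ord0 i = 1 \/ (x - y) ord0 i = - 1.
  by move: zi; move: ((x - y) ord0 i) => t; lia.
- exists (y, i); right; split=> //=; apply/eqP; rewrite addrC -subr_eq.
  apply/eqP/rowP => j; rewrite [RHS]mxE ?eqxx /=.
  by case: eqVneq => [->|/zj].
- exists (x, i); left; split=> //=; apply/eqP; rewrite addrC -subr_eq.
  apply/eqP/rowP => j; rewrite -opprB mxE [RHS]mxE ?eqxx /=.
  by case: eqVneq => [->|/zj ->]; rewrite ?e ?opprK ?oppr0.
Qed.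

Lemma joins_inj (d : nat) (e f : edge d) (x y : lattice d) :
  joins e x y -> joins f x y -> e = f.
Proof.
have ui (i j : 'I_d) : unit_vec i = unit_vec j -> i = j.
  move/rowP/(_ i); rewrite !mxE !eqxx /=; case: eqVneq => //.
have uN (i j : 'I_d) (z : lattice d) : z <> z + unit_vec i + unit_vec j.
  rewrite -addrA -[X in X <> _]addr0 => /addrI /esym /rowP /(_ i).
  by rewrite !mxE !eqxx /=; case: eqP.
case: e f => [z i] [z' j] [] [/= -> ->] [] [/=].
- by move=> <- /addrI /ui ->.
- by move=> <- /uN.
- by move=> <- /uN.
- by move=> <- /addrI /ui ->.
Qed.

Definition incident (d : nat) (e : edge d) (x : lattice d) : Prop :=
  exists y, joins e x y.

Definition cylinders (d : nat) : set (set (edge d -> bool)) :=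
  [set C | exists (e : edge d) (b : bool), C = [set w | w e = b]].

(* {0,1}^E with the product sigma-algebra; [true] means open. *)
Definition config (d : nat) := g_sigma_algebraType (@cylinders d).

Definition is_percolation_measure (d : nat) (R : realType) (p : R)
    (P : probability (config d) R) : Prop :=
  mutually_independent P (fun (e : edge d) (w : config d) => w e) /\
  forall e : edge d, P [set w | w e = true] = p%:E.

(* P_p is the law of the p-biased binary digits of a uniform real number. *)
Section Existence.
Variables (R : realType) (p : R).
Hypothesis p01 : 0 <= p <= 1.
Local Ltac lra_p := have ? := p01; lra.
Local Ltac nra_p := have ? := p01; nra.

Let digit_shift (u : R) : R := if u < p then u / p else (u - p) / (1 - p).
Let digit (n : nat) (u : R) : bool := iter n digit_shift u < p.

Let q (b : bool) : R := if b then p else 1 - p.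

Let qs (A : set bool) : R :=
  (if `[< A true >] then q true else 0) +
  (if `[< A false >] then q false else 0).

Let len (s : seq bool) : R := \prod_(b <- s) q b.

Let q_ge0 b : 0 <= q b.
Proof. by case: b; rewrite /q /=; lra_p. Qed.

Fixpoint digit_cyl (s : seq bool) : set R :=
  if s is b :: s' then
    [set u | 0 <= u < 1 /\ (u < p) = b /\ digit_cyl s' (digit_shift u)]
  else [set u | 0 <= u < 1].

Let cyl01 s u : digit_cyl s u -> 0 <= u < 1.
Proof. by case: s => [|b s] //= [? _]. Qed.

Let cyl_rcons s b u :
  digit_cyl (rcons s b) u <-> digit_cyl s u /\ digit (size s) u = b.
Proof.
elim: s b u => [|c s ih] b u /=.
  rewrite /digit /=; split.
    by move=> [u01 [ub _]].
  move=> [u01 ub]; split => //; split => //.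
  move: ub u01 p01; rewrite /digit_shift; case: ifP => up _ u01 _.
    have p0 : 0 < p by lra_p.
    by rewrite ler_pdivlMr // ltr_pdivrMr //; lra_p.
  have p0 : 0 < 1 - p by lra_p.
  rewrite ler_pdivlMr // ltr_pdivrMr //; lra_p.
rewrite /digit iterSr -/(digit _ _).
split.
  by move=> [? [? /ih [? ?]]].
by move=> [[? [? ?]] ?]; do 2!split => //; apply/ih.
Qed.

Let len_ge0 s : 0 <= len s.
Proof. by apply: prodr_ge0. Qed.

Let cyl_itv s : exists a, digit_cyl s = `[a, a + len s[%classic.
Proof.
elim: s => [|b s [a ih]].
  exists 0; apply/seteqP.
  by split=> u /=; rewrite in_itv /= /len big_nil add0r.
have c01 := @cyl01 s; rewrite ih in c01.
have l0 := len_ge0 s.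
have -> : len (b :: s) = q b * len s by rewrite /len big_cons.
have {}c01 x : a <= x < a + len s -> 0 <= x < 1.
  by move=> h; apply: c01; rewrite /= in_itv.
case: b; rewrite /q /=.
- have [p0|p0] := ltP 0 p; last first.
    exists 0; apply/seteqP; split=> u /=; rewrite in_itv /=.
      by move=> [? [? _]]; lra_p.
    nra_p.
  exists (p * a); apply/seteqP; split=> u /=.
    rewrite ih /= in_itv /=  /digit_shift => -[u01 [->]].
    by rewrite in_itv /= ler_pdivlMr // ltr_pdivrMr //; lra_p.
  rewrite in_itv /= => h.
  have h1 : a <= u / p < a + len s.
    by rewrite ler_pdivlMr // ltr_pdivrMr //; lra_p.
  have := c01 _ h1; rewrite ler_pdivlMr // ltr_pdivrMr // => h2.
  have up : u < p by lra_p.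
  by rewrite /digit_shift up ih /= in_itv /=; split => //; lra_p.
- have [p0|p0] := ltP 0 (1 - p); last first.
    exists 0; apply/seteqP; split=> u /=; rewrite in_itv /=.
      by move=> [? [? _]]; lra_p.
    nra_p.
  exists (p + (1 - p) * a); apply/seteqP; split=> u /=.
    rewrite ih /= in_itv /=  /digit_shift => -[u01 [->]].
    by rewrite in_itv /= ler_pdivlMr // ltr_pdivrMr //; lra_p.
  rewrite in_itv /= => h.
  have h1 : a <= (u - p) / (1 - p) < a + len s.
    by rewrite ler_pdivlMr // ltr_pdivrMr //; lra_p.
  have := c01 _ h1; rewrite ler_pdivlMr // ltr_pdivrMr // => h2.
  have up : (u < p) = false by apply/negbTE; rewrite -leNgt; lra_p.
  by rewrite /digit_shift up ih /= in_itv /=; split => //; lra_p.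
Qed.

Let U := (uniform_prob (@ltr01 R) : probability _ R).
Let TR := g_sigma_algebraType (R.-ocitv.-measurable).

Let cyl_measurable s : measurable (digit_cyl s : set TR).
Proof. by have [a ->] := cyl_itv s; exact: measurable_itv. Qed.

Let U_cyl s : U (digit_cyl s) = (len s)%:E.
Proof.
have [a e] := cyl_itv s.
transitivity (\int[lebesgue_measure]_(x in digit_cyl s) (cst 1%:E x : \bar R))%E.
  apply: eq_integral => x /set_mem /cyl01 x01.
  by rewrite /uniform_pdf ifT ?subr0 ?invr1 //; lra_p.
rewrite integral_cst ?mul1e //.
rewrite e; apply: etrans (lebesgue_measure_itv `[a, a + len s[%R) _; rewrite /= lte_fin.
have l0 := len_ge0 s.
by case: ifPn => h; [rewrite -EFinD; congr (_%:E); lra_p | congr (_%:E); lra_p].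
Qed.

Let G (N : nat) (A : nat -> set bool) (s : seq bool) : set TR :=
  [set u | digit_cyl s u /\
           forall i, (size s <= i < N)%N -> A i (digit i u)].

Let G_law A n s : measurable (G (n + size s) A s) /\
  U (G (n + size s) A s) =
  (len s * \prod_(size s <= i < n + size s) qs (A i))%:E.
Proof.
elim: n s => [|n ih] s.
  have -> : G (0 + size s) A s = digit_cyl s.
    by apply/seteqP; split=> u /=; [case | move=> cu; split => // i; lia].
  by split=> //; rewrite U_cyl big_geq // mulr1.
pose k := size s.
pose H b : set TR := if `[< A k b >] then G (n.+1 + k) A (rcons s b) else set0.
have sz b : (n.+1 + k = n + size (rcons s b))%N by rewrite size_rcons addnS.
have mH b : measurable (H b).
  rewrite /H; case: ifP => // _; rewrite (sz b); exact: (ih (rcons s b)).1.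
have UH b : U (H b) = ((if `[< A k b >] then q b else 0) * len s *
    \prod_(k.+1 <= i < n.+1 + k) qs (A i))%:E.
  rewrite /H; case: ifP => _; last by rewrite measure0 !mul0r.
  rewrite (sz b) (ih (rcons s b)).2 size_rcons /len -cats1 big_cat big_seq1 /=.
  by congr (_%:E); ring.
have -> : G (n.+1 + size s) A s = H true `|` H false.
  apply/seteqP; split=> u /=.
    move=> [cu hu]; have hk := hu k _.
    have {}hk : A k (digit k u) by apply: hk; rewrite /k; lia.
    have : H (digit k u) u.
      rewrite /H ifT; last exact/asboolP.
      split; first by apply/cyl_rcons.
      by move=> i; rewrite size_rcons => hi; apply: hu; rewrite -/k; lia.
    by case: (digit k u); [left|right].
  have HH b : H b u -> G (n.+1 + size s) A s u.
    rewrite /H; case: ifP => // /asboolP Ab [/cyl_rcons [cu du] hu].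
    split => // i hi; have [->|ik] := eqVneq i k; first by rewrite du.
    by apply: hu; rewrite size_rcons; move: ik; rewrite /k; lia.
  by case; apply: HH.
split; first exact: measurableU.
have -> : U (H true `|` H false) = (U (H true) + U (H false))%E.
  apply: measureU => //; apply/seteqP; split=> u //= [].
  rewrite /H; case: ifP => // _; case: ifP => // _.
  by move=> [/cyl_rcons [_ dt] _] [/cyl_rcons [_ df] _]; rewrite dt in df.
rewrite !UH -EFinD [in RHS]big_ltn; last lia.
by congr (_%:E); rewrite -/k /qs; ring.
Qed.

Let digit_measurable i b : measurable ([set u | digit i u = b] : set TR).
Proof.
have ms : measurable_fun [set: TR] (digit_shift : TR -> TR).
  apply: measurable_fun_ifT.
  - exact: measurable_fun_ltr.
  - by apply: measurable_funM.
  - by apply: measurable_funM => //; exact: measurable_funB.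
have mi : measurable_fun [set: TR] (iter i digit_shift : TR -> TR).
  by elim: i => [|i ih]; [exact: measurable_id | exact: measurableT_comp].
have /(_ measurableT [set b]) : measurable_fun [set: TR] (digit i).
  by apply: measurable_fun_ltr.
by rewrite setTI; apply.
Qed.

Let digits_law (A : nat -> set bool) N :
  U [set u | forall i, (i < N)%N -> A i (digit i u)] =
  (\prod_(0 <= i < N) qs (A i))%:E.
Proof.
set S := [set u | _].
have mS : measurable (S : set TR).
  rewrite (_ : S = \bigcap_(i in [set i | (i < N)%N])
                     [set u | A i (digit i u)]) //.
  apply: bigcap_measurableType => i _.
  rewrite (_ : [set u | _] = \bigcup_(b in A i) [set u | digit i u = b]).
    by apply: fin_bigcup_measurable => [|b _];
      [exact: finite_finset | exact: digit_measurable].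
  by apply/seteqP; split=> u /=; [exists (digit i u) | case=> b Ab /= ->].
have [mG UG] := G_law A N [::].
rewrite addn0 /len big_nil mul1r in mG UG.
rewrite -UG.
have -> : G N A [::] = S `&` digit_cyl [::].
  apply/seteqP; split => u.
    by move=> [cu hu]; split => // i iN; apply: hu; rewrite iN.
  by move=> [hu cu]; split => // i /andP[_]; exact: hu.
have U1 : U (~` digit_cyl [::]) = 0%E.
  by rewrite probability_setC // U_cyl /len big_nil subee.
rewrite -[in LHS](setIT S) -(setUv (digit_cyl [::])) setIUr measureU //.
- rewrite [X in (_ + X)%E](_ : _ = 0%E) ?adde0 //.
  apply: (subset_measure0 _ _ _ U1) => //.
  + by apply: measurableI => //; exact: measurableC.
  + exact: measurableC.
- exact: measurableI.
- by apply: measurableI => //; exact: measurableC.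
- by rewrite setIACA setICr setI0.
Qed.


Lemma percolation_measure_exists (d : nat) :
  exists P : probability (config d) R, is_percolation_measure p P.
Proof.
pose w (u : TR) : config d := fun e => digit (pickle e) u.
have mw : measurable_fun [set: TR] w.
  apply: (@measurability _ _ TR (config d) setT w (@cylinders d) erefl).
  move=> _ [_ [e [b ->]] <-].
  by rewrite setTI; exact: digit_measurable.
pose w' : {mfun TR >-> config d} := mfun_Sub (mem_set mw).
exists (distribution U w').
have law (s : seq (edge d)) (A : edge d -> set bool) : uniq s ->
    distribution U w' [set c | forall e, e \in s -> A e (c e)] =
    (\prod_(e <- s) qs (A e))%:E.
  have qsT : qs setT = 1.
    by rewrite /qs !ifT; [rewrite /q addrC subrK | exact/asboolP..].
  move=> us.
  pose A' i := if pickle_inv i is Some e then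
                 (if e \in s then A e else setT) else setT.
  pose N := (\max_(e <- s) (pickle e).+1)%N.
  transitivity (U [set u | forall i, (i < N)%N -> A' i (digit i u)]).
    congr (U _); apply/seteqP; split=> u /= hu.
      move=> i _; rewrite /A'; case ei : (pickle_inv i) => [e|//].
      case: ifP => // /hu; rewrite /w.
      by have := pickle_invK (T := edge d) i; rewrite ei /= => ->.
    move=> e es; have := hu (pickle e).
    rewrite /A' pickleK_inv es; apply.
    by rewrite /N (big_rem e es) /= leq_max leqnn.
  rewrite digits_law; congr (_%:E).
  rewrite (bigID (fun i => i \in map pickle s)) /= [X in _ * X]big1 ?mulr1.
    rewrite -big_filter (perm_big (map pickle s)).
      rewrite big_map; apply: eq_big_seq => e es.
      by rewrite /A' pickleK_inv es.
    apply: uniq_perm.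
    - by rewrite filter_uniq // iota_uniq.
    - by rewrite map_inj_uniq //; exact: pcan_inj pickleK.
    move=> i; rewrite mem_filter; case: mapP => //= -[e es ->].
    by rewrite mem_index_iota /= /N (big_rem e es) /= leq_max leqnn.
  move=> i /negP ni; rewrite /A'.
  case ei : (pickle_inv i) => [e|//]; case: ifP => // es; case: ni.
  apply/mapP; exists e => //.
  by have := pickle_invK (T := edge d) i; rewrite ei /=.
have law1 (e : edge d) (A : set bool) :
    distribution U w' [set c | A (c e)] = (qs A)%:E.
  have := law [:: e] (fun=> A) isT; rewrite big_seq1 => <-.
  congr (distribution U w' _); apply/seteqP; split=> c /=.
    by move=> Ac f; rewrite inE => /eqP ->.
  by apply; rewrite mem_head.
split.
  move=> s A us; apply: etrans (law s A us) _; congr (_%:E).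
  by apply: eq_bigr => e _; rewrite [X in fine X]law1.
move=> e; apply: etrans (law1 e [set true]) _.
rewrite /qs ifT; last exact/asboolP.
by rewrite ifF ?addr0 //; apply/negbTE/asboolPn.
Qed.

End Existence.

Lemma percolation_measure_unique (R : realType) (p : R) (d : nat)
    (P Q : probability (config d) R) :
  is_percolation_measure p P -> is_percolation_measure p Q ->
  forall A : set (config d), measurable A -> P A = Q A.
Proof.
move=> [indP openP] [indQ openQ].
have m1 (e : edge d) b : measurable ([set w | w e = b] : set (config d)).
  by apply: sub_sigma_algebra; exists e, b.
have marg (e : edge d) (B : set bool) :
    P [set w | B (w e)] = Q [set w | B (w e)].
  have closed b : P [set w | w e = b] = Q [set w | w e = b].
    case: b; first by rewrite openP openQ.
    rewrite (_ : [set w | _] = ~` [set w : config d | w e = true]).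
      by rewrite !probability_setC // openP openQ.
    by apply/seteqP; split=> w /=; case: (w e).
  have [Bt|Bt] := pselect (B true); have [Bf|Bf] := pselect (B false).
  - rewrite (_ : [set w | _] = setT) ?probability_setT //.
    by apply/seteqP; split=> w //= _; case: (w e).
  - rewrite (_ : [set w | _] = [set w : config d | w e = true]) //.
    by apply/seteqP; split=> w /=; case: (w e).
  - rewrite (_ : [set w | _] = [set w : config d | w e = false]) //.
    by apply/seteqP; split=> w /=; case: (w e).
  - rewrite (_ : [set w | _] = set0) ?measure0 //.
    by apply/seteqP; split=> w //=; case: (w e).
pose G : set (set (config d)) := [set C | exists (s : seq (edge d))
  (B : edge d -> set bool), uniq s /\
  C = [set w | forall e, e \in s -> B e (w e)]].
have mG : G `<=` measurable.
  move=> _ [s [B [_ ->]]].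
  rewrite (_ : [set w | _] =
      \bigcap_(e in [set` s]) [set w : config d | B e (w e)]) //.
  apply: fin_bigcap_measurable => // e _.
  rewrite (_ : [set w | _] = \bigcup_(b in B e) [set w : config d | w e = b]).
    by apply: fin_bigcup_measurable => // ; exact: finite_finset.
  by apply/seteqP; split=> w /=; [exists (w e) | case=> b Ab /= ->].
have GI : setI_closed G.
  move=> _ _ [s [B [_ ->]]] [s' [B' [_ ->]]].
  exists (undup (s ++ s')), (fun e => (if e \in s then B e else setT) `&`
                                (if e \in s' then B' e else setT)).
  split; first exact: undup_uniq.
  apply/seteqP; split=> w /=.
    move=> [h h'] e _; split; case: ifP => //; [exact: h | exact: h'].
  move=> h; split=> e es; have := h e; rewrite mem_undup mem_cat es ?orbT.
    by case=> // ? _.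
  by case=> // _.
have GPQ A : G A -> P A = Q A.
  move=> [s [B [us ->]]]; apply: etrans (indP s B us) _.
  apply: etrans (esym (indQ s B us)); congr (_%:E).
  by apply: eq_bigr => e _; congr fine; exact: marg.
move=> A mA.
apply: (@g_sigma_algebra_measure_unique _ _ _ G mG (fun=> setT)) => //.
- move=> _; exists [::], (fun=> setT); split=> //.
  by apply/seteqP; split.
- by rewrite bigcup_const //; exists 0%N.
- move=> k; rewrite [X in (X < _)%E](_ : _ = 1%E) ?ltry //.
  exact: probability_setT.
- apply: (smallest_sub _ _ mA); first exact: smallest_sigma_algebra.
  move=> _ [e [b ->]]; apply: sub_sigma_algebra.
  exists [:: e], (fun=> [set b]).
  split=> //; apply/seteqP; split=> w /=.
    by move=> we f; rewrite inE => /eqP ->.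
  by apply; rewrite mem_head.
Qed.

Definition shielded (d : nat) (w : config d) (x : lattice d) : Prop :=
  forall e : edge d, incident e x -> w e = false.

Definition infinite_shielded_path (d : nat) (w : config d)
    (v : nat -> lattice d) (e : nat -> edge d) : Prop :=
  [/\ forall n, joins (e n) (v n) (v n.+1),
      injective v &
      forall n, shielded w (v n)].

Definition shield_percolates (d : nat) : set (config d) :=
  [set w | exists v e, infinite_shielded_path w v e].

(* [P] below is P_p: it exists and is unique by
   [percolation_measure_exists] and [percolation_measure_unique]. *)
Definition p_shield (R : realType) (d : nat) : R :=
  sup [set p : R | 0 <= p <= 1 /\
    exists P : probability (config d) R,
      is_percolation_measure p P /\ (0 < P (@shield_percolates d))%E].

(* Steps are indexed from 0: [X k] is the (k+1)-st step X_{k+1}. *)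
Definition walk (d : nat) (T : Type) (X : nat -> T -> lattice d) (n : nat)
    (t : T) : lattice d :=
  \sum_(k < n) X k t.

Definition uniform_step (d : nat) (disp : measure_display)
    (T : measurableType disp) (R : realType) (P : probability T R)
    (Y : T -> lattice d) : Prop :=
  discrete_random_element Y /\
  forall i : 'I_d, P (Y @^-1` [set unit_vec i]) = (d%:R^-1)%:E.

(* Two independent i.i.d. sequences: the family made of all the X_n and all
   the X'_n is mutually independent. *)
Definition indep_walks (d : nat) (disp : measure_display)
    (T : measurableType disp) (R : realType) (P : probability T R)
    (X X' : nat -> T -> lattice d) : Prop :=
  [/\ forall n, uniform_step P (X n),
      forall n, uniform_step P (X' n) &
      mutually_independent P
        (fun k : nat + nat => match k with inl n => X n | inr n => X' n end)].

Definition p2 (d : nat) (disp : measure_display) (T : measurableType disp)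
    (R : realType) (P : probability T R) (X X' : nat -> T -> lattice d) : R :=
  cond_prob P
    [set t | exists2 n, (2 <= n)%N & l1 (walk X n t - walk X' n t) = 2%N]
    [set t | l1 (walk X 1 t - walk X' 1 t) = 2%N].

(* Main.v *)
Require Import Defs.
From mathcomp Require Import all_boot all_order all_algebra.
From mathcomp Require Import all_classical all_reals all_analysis.
From mathcomp Require Import measurable_realfun fingroup perm finmap.
From mathcomp Require Import ring lra zify.

Set Implicit Arguments.
Unset Strict Implicit.
Unset Printing Implicit Defensive.

Import Order.TTheory GRing.Theory Num.Theory.
Import numFieldNormedType.Exports.
Local Open Scope classical_set_scope.
Local Open Scope ring_scope.

(** The second moment method is applied to the oriented shielded paths of length
    [n] from the origin, that is, those whose steps are unit vectors.  With
    [q = 1 - p], the expectation of the square of their number, divided by the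
    square of the expectation, is the mean of [q] to the power minus the number
    of edges that touch both of two independent uniform oriented paths.  If this
    ratio is bounded in [n], the probability that such a path exists is bounded
    away from zero ([second_moment], [shielded_to_prob]), and by compactness an
    infinite one exists with positive probability ([koenig], [percolates]).

    Edges touching both paths are counted layer by layer ([card_step_edgesI]).
    The paths share edges only in a layer where they agree at the bottom or at
    the top, or possibly one edge when their difference has norm two before and
    after the step.  Hence the mean weight is that of a Markov chain, the
    difference of the two walks, and it is cut into excursions between the times
    when the difference has norm two.  An excursion that avoids the origin
    contributes at most [(p2 - 1 / d ^ 2) / q]; one through the origin
    contributes a geometric series, which converges by the first condition and
    whose sum is the remaining term of the second condition.  This condition
    thus forces the mean weight of an excursion below one, so that the total
    weight is bounded ([energy_le]).

    The quantity [p2] enters through a lower bound only: it is at least the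
    return probability up to any finite horizon ([le_p2], [avoid_le_p2]), which
    is computed by counting words of steps, and which by permuting coordinates
    is the same for all differences of norm two ([avg_hit_sym]). *)

(** * The second moment method *)

Section SecondMoment.
Context {disp : measure_display} {T : measurableType disp} {R : realType}.
Variable P : probability T R.

Lemma integral_indic_sum (I : Type) (r : seq I) (c : I -> R) (A : I -> set T) :
  (forall i, 0 <= c i) -> (forall i, measurable (A i)) ->
  (\int[P]_t (\sum_(i <- r) c i * \1_(A i) t)%:E)%E =
  (\sum_(i <- r) c i * fine (P (A i)))%:E.
Proof.
move=> c0 mA.
have mI i : measurable_fun setT (fun t => (\1_(A i) t)%:E : \bar R).
  by apply/measurable_EFinP; exact: measurable_indic.
under eq_integral => t _.
  rewrite -sumEFin; under eq_bigr => i _ do rewrite EFinM.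
  over.
rewrite ge0_integral_sum //.
- rewrite -sumEFin; apply: eq_bigr => i _.
  have -> : (\int[P]_t ((c i)%:E * (\1_(A i) t)%:E) =
             (c i)%:E * \int[P]_t (\1_(A i) t)%:E)%E.
    by apply: ge0_integralZl => //; exact: c0.
  by rewrite integral_indic // setIT EFinM fineK // fin_num_measure.
- by move=> i; exact: measurable_funeM.
- by move=> i t _; rewrite -EFinM lee_fin mulr_ge0.
Qed.

(** Inequalities between simple functions pass to probabilities by
    integration. *)
Lemma le_prob_sum (I J : Type) (r : seq I) (s : seq J)
    (a : I -> R) (b : J -> R) (A : I -> set T) (B : J -> set T) :
  (forall i, 0 <= a i) -> (forall i, measurable (A i)) ->
  (forall j, 0 <= b j) -> (forall j, measurable (B j)) ->
  (forall t, \sum_(i <- r) a i * \1_(A i) t <= \sum_(j <- s) b j * \1_(B j) t)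
  -> \sum_(i <- r) a i * fine (P (A i)) <= \sum_(j <- s) b j * fine (P (B j)).
Proof.
move=> a0 mA b0 mB le_ab; rewrite -lee_fin -!integral_indic_sum //.
have mS (K : Type) (u : seq K) (c : K -> R) (C : K -> set T) :
    (forall k, measurable (C k)) ->
    measurable_fun setT (fun t => (\sum_(k <- u) c k * \1_(C k) t)%:E).
  move=> mC; apply/measurable_EFinP.
  apply: measurable_sum => k.
  by apply: measurable_funM => //; exact: measurable_indic.
apply: ge0_le_integral => //; [|exact: mS|exact: mS|].
- by move=> t _; rewrite lee_fin; apply: sumr_ge0 => i _; exact: mulr_ge0.
- by move=> t _; rewrite lee_fin.
Qed.

Lemma le_prob_disjoint (I : eqType) (r : seq I) (E : I -> set T) (B : set T) :
  uniq r -> (forall i, measurable (E i)) -> measurable B ->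
  (forall i j t, i \in r -> j \in r -> E i t -> E j t -> i = j) ->
  (forall i, i \in r -> E i `<=` B) ->
  \sum_(i <- r) fine (P (E i)) <= fine (P B).
Proof.
move=> ur mE mB dE EB.
have := @le_prob_sum I unit r [:: tt] (fun=> 1) (fun=> 1) E (fun=> B).
rewrite big_seq1 mul1r; under eq_bigr do rewrite mul1r.
apply => // t; rewrite big_seq1 mul1r.
have [/hasP[i ir /asboolP Ei]|/hasPn nE] :=
  boolP (has (fun i => `[< E i t >]) r).
  rewrite (bigD1_seq i) //= big_seq_cond big1 => [|j /andP[jr ji]].
    by rewrite addr0 mul1r !indicE !mem_set //; exact: (EB i).
  rewrite mul1r indicE memNset // => Ej.
  by rewrite (dE _ _ _ ir jr Ei Ej) eqxx in ji.
rewrite big_seq big1 => [|i]; first by rewrite indicE.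
move=> /nE/asboolP Ei.
by rewrite mul1r indicE memNset.
Qed.

(** The weighted second moment method: with [N = \sum_i c_i 1_(A_i)], the
    pointwise bound [2 x N <= 1_(N > 0) + (x N)^2] is integrated with
    [x = 1 / (K E[N])]. *)
Lemma second_moment (I : eqType) (r : seq I) (c : I -> R) (A : I -> set T)
    (K : R) :
  (forall i, 0 <= c i) -> (forall i, measurable (A i)) ->
  0 < K -> 0 < \sum_(i <- r) c i * fine (P (A i)) ->
  \sum_(i <- r) \sum_(j <- r) c i * c j * fine (P (A i `&` A j)) <=
    K * (\sum_(i <- r) c i * fine (P (A i))) ^+ 2 ->
  K^-1 <= fine (P (\bigcup_(i in [set` r]) A i)).
Proof.
move=> c0 mA K0; set M2 := \sum_(i <- r) _; set M := \sum_(i <- r) _ => M0 leM.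
set U := \bigcup_(i in _) _.
have mU : measurable U by apply: fin_bigcup_measurable.
pose x := (K * M)^-1.
have x0 : 0 < x by rewrite invr_gt0 mulr_gt0.
pose s := None :: map Some [seq (i, j) | i <- r, j <- r].
pose b (o : option (I * I)) : R :=
  if o is Some ij then x ^+ 2 * (c ij.1 * c ij.2) else 1.
pose B (o : option (I * I)) := if o is Some ij then A ij.1 `&` A ij.2 else U.
have : \sum_(i <- r) (2 * x * c i) * fine (P (A i)) <=
       \sum_(o <- s) b o * fine (P (B o)).
  apply: le_prob_sum.
  - by move=> i; rewrite !mulr_ge0 // ltW.
  - by [].
  - by case=> [[i j]|] //=; rewrite !mulr_ge0 ?exprn_ge0 // ltW.
  - by case=> [[i j]|] //=; exact: measurableI.
  move=> t; rewrite big_cons big_map big_allpairs /= mul1r.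
  pose N := \sum_(i <- r) c i * \1_(A i) t.
  have -> : \sum_(i <- r) 2 * x * c i * \1_(A i) t = 2 * (x * N).
    by rewrite /N !mulr_sumr; apply: eq_bigr => i _; rewrite !mulrA.
  have -> : \sum_(i <- r) \sum_(j <- r)
      x ^+ 2 * (c i * c j) * \1_(A i `&` A j) t = (x * N) ^+ 2.
    rewrite exprMn [N ^+ 2]expr2 {1}/N mulr_suml mulr_sumr.
    apply: eq_bigr => i _; rewrite /N !mulr_sumr; apply: eq_bigr => j _.
    by rewrite indicI /= ; ring.
  have [tU|tU] := pselect (U t).
    rewrite indicE mem_set //=; have := sqr_ge0 (x * N - 1); lra.
  have -> : N = 0.
    rewrite /N big_seq big1 // => i ir; rewrite indicE memNset ?mulr0 //.
    by move=> tA; apply: tU; exists i.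
  by rewrite !mulr0 expr0n /= addr0 indicE.
rewrite big_cons big_map big_allpairs /= mul1r.
have -> : \sum_(i <- r) 2 * x * c i * fine (P (A i)) = 2 * x * M.
  by rewrite /M mulr_sumr; apply: eq_bigr => i _; rewrite !mulrA.
have -> : \sum_(i <- r) \sum_(j <- r)
      x ^+ 2 * (c i * c j) * fine (P (A i `&` A j)) = x ^+ 2 * M2.
  rewrite /M2 mulr_sumr; apply: eq_bigr => i _.
  by rewrite mulr_sumr; apply: eq_bigr => j _; rewrite !mulrA.
have -> : 2 * x * M = 2 * K^-1 by rewrite /x; field; lra.
have : x ^+ 2 * M2 <= K^-1.
  have -> : K^-1 = x ^+ 2 * (K * M ^+ 2) by rewrite /x; field; lra.
  by rewrite ler_wpM2l // exprn_ge0 // ltW.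
lra.
Qed.

End SecondMoment.

(** * Words of steps *)

Section Words.
Variable A : finType.

Fixpoint words (n : nat) : seq (seq A) :=
  if n is m.+1 then [seq a :: s | a <- enum A, s <- words m] else [:: [::]].

Lemma mem_words n s : (s \in words n) = (size s == n).
Proof.
elim: n s => [|n ih] s /=; first by rewrite inE -size_eq0.
apply/allpairsP/idP => [[[a t] /= [_ + ->]]|]; first by rewrite ih.
by case: s => // a s; rewrite eqSS -ih => sn; exists (a, s); rewrite mem_enum.
Qed.

Lemma words_uniq n : uniq (words n).
Proof.
elim: n => //= n ih; apply: allpairs_uniq => //; first exact: enum_uniq.
by move=> [a s] [b t] _ _ /= [-> ->].
Qed.

Lemma big_words_recl (V : nmodType) n (F : seq A -> V) :
  \sum_(s <- words n.+1) F s = \sum_a \sum_(s <- words n) F (a :: s).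
Proof. by rewrite big_allpairs_dep big_enum. Qed.

Lemma big_words2_recl (V : nmodType) n (F : seq A -> seq A -> V) :
  \sum_(s <- words n.+1) \sum_(t <- words n.+1) F s t =
  \sum_(p : A * A) \sum_(s <- words n) \sum_(t <- words n)
    F (p.1 :: s) (p.2 :: t).
Proof.
transitivity (\sum_a \sum_b \sum_(s <- words n) \sum_(t <- words n)
  F (a :: s) (b :: t)); last exact: pair_bigA.
rewrite big_words_recl; apply: eq_bigr => a _.
rewrite [RHS]exchange_big /=; apply: eq_bigr => s _.
by rewrite big_words_recl.
Qed.

Lemma size_words n : size (words n) = (#|A| ^ n)%N.
Proof. by elim: n => //= n ih; rewrite size_allpairs -cardE ih expnS. Qed.

End Words.

(** * Edges that touch two oriented paths *)

Section Edges.
Variable d : nat.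
Local Notation u := (@unit_vec d).
Implicit Types (x y z : lattice d) (i j k : 'I_d) (s t : seq 'I_d).

Lemma unit_vecE i j : u i ord0 j = (j == i)%:R.
Proof. by rewrite mxE eqxx. Qed.

Lemma unit_vec_inj : injective u.
Proof.
by move=> i j /rowP/(_ i); rewrite !unit_vecE eqxx; case: eqVneq.
Qed.

Lemma unit_vec_addI i j k l : u i + u j = u k + u l ->
  (i = k /\ j = l) \/ (i = l /\ j = k).
Proof.
move=> e; have ei := congr1 (fun z : lattice d => z ord0 i) e.
have [ik|ik] := eqVneq i k.
  by left; split=> //; apply: unit_vec_inj; move: e; rewrite ik => /addrI.
have [il|il] := eqVneq i l.
  right; split=> //; apply: unit_vec_inj; move: e.
  by rewrite il [RHS]addrC => /addrI.
by move: ei; rewrite /= !mxE !eqxx /= (negbTE ik) (negbTE il); case: (i == j).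
Qed.

Definition height x : int := \sum_(i < d) x ord0 i.

Lemma heightD x y : height (x + y) = height x + height y.
Proof. by rewrite -big_split; apply: eq_bigr => i _; rewrite mxE. Qed.

Lemma height_unit i : height (u i) = 1.
Proof.
rewrite /height (bigD1 i) //= unit_vecE eqxx big1 ?addr0 // => j ji.
by rewrite unit_vecE (negbTE ji).
Qed.

Definition up_edges x : {fset edge d} := [fset (x, k) | k in 'I_d]%fset.
Definition down_edges x : {fset edge d} := [fset (x - u k, k) | k in 'I_d]%fset.

Lemma up_edgesP e x : reflect (e.1 = x) (e \in up_edges x).
Proof.
apply: (iffP (imfsetP _ _ _ _)) => [[k _ ->]//|].
by case: e => y k /= ->; exists k.
Qed.

Lemma down_edgesP e x : reflect (e.1 + u e.2 = x) (e \in down_edges x).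
Proof.
apply: (iffP (imfsetP _ _ _ _)) => [[k _ ->]/=|]; first by rewrite subrK.
by case: e => y k /= <-; exists k => //=; rewrite addrK.
Qed.

Lemma card_up_edges x : (#|` up_edges x| <= d)%N.
Proof. by rewrite (leq_trans (leq_imfset_card _ _ _)) // -cardE card_ord. Qed.

Lemma card_down_edges x : (#|` down_edges x| <= d)%N.
Proof. by rewrite (leq_trans (leq_imfset_card _ _ _)) // -cardE card_ord. Qed.

(** The edges that must be closed along an oriented path are sorted by layers
    between consecutive heights, where different layers share no edge; this is
    the layer of the step from [x] to [x + u i]. *)
Definition step_edges x i : {fset edge d} :=
  (up_edges x `|` down_edges (x + u i)%R)%fset.

Fixpoint edges_above x s : {fset edge d} :=
  if s is i :: s' then (step_edges x i `|` edges_above (x + u i)%R s')%fset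
  else up_edges x.

Definition path_edges x s : {fset edge d} :=
  (down_edges x `|` edges_above x s)%fset.

Definition two_apart z : bool :=
  [exists p : 'I_d * 'I_d, (p.1 != p.2) && (z == u p.1 - u p.2)].

Lemma two_apartP z :
  reflect (exists i j, i != j /\ z = u i - u j) (two_apart z).
Proof.
apply: (iffP existsP) => [[[i j] /= /andP[ij /eqP zij]]|[i [j [ij zij]]]].
  by exists i, j.
by exists (i, j); rewrite /= ij zij eqxx.
Qed.

Lemma two_apart_neq0 z : two_apart z -> z != 0.
Proof.
move=> /two_apartP[i [j [ij ->]]]; rewrite subr_eq0; apply: contra ij.
by move=> /eqP/unit_vec_inj ->.
Qed.

Definition step_diff (p : 'I_d * 'I_d) : lattice d := u p.1 - u p.2.

Lemma step_diff_eq0 p : (step_diff p == 0) = (p.1 == p.2).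
Proof. by rewrite subr_eq0 (inj_eq unit_vec_inj). Qed.

(** A bound on the number of edges that two paths at difference [z], taking the
    steps [p.1] and [p.2], have in common in one layer.  If they meet at the
    bottom, they share the [d] edges above the common vertex, at the top the
    [d] edges below it, and one edge is counted twice if they do both.
    Otherwise a common edge joins the bottom of one step to the top of the
    other, so that the paths are two apart before and after the step; there is
    at most one, as two of them would make the paths meet. *)
Definition cost z p : nat :=
  if z == 0 then (if z + step_diff p == 0 then (2 * d - 1)%N else d)
  else if z + step_diff p == 0 then d
  else two_apart z && two_apart (z + step_diff p).

Lemma card_step_edgesI x y i j :
  (#|` step_edges x i `&` step_edges y j|%fset <= cost (x - y)%R (i, j))%N.
Proof.
have sum0 : (x - y + step_diff (i, j) == 0) = (x + u i == y + u j).
  by rewrite -[RHS]subr_eq0 /step_diff /= opprD addrACA.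
rewrite /cost sum0 subr_eq0.
have [->|xy] := eqVneq x y.
  have [/addrI/unit_vec_inj ->|ij] := eqVneq (y + u i) (y + u j).
    rewrite fsetIid.
    have lt1 : (0 < #|` up_edges y `&` down_edges (y + u j)%R|%fset)%N.
      rewrite cardfs_gt0; apply/fset0Pn; exists (y, j).
      by rewrite inE; apply/andP; split; [apply/up_edgesP|apply/down_edgesP].
    have := cardfsUI (up_edges y) (down_edges (y + u j)).
    have := card_up_edges y; have := card_down_edges (y + u j).
    rewrite /step_edges; lia.
  apply: leq_trans (card_up_edges y); apply: fsubset_leq_card; apply/fsubsetP => e.
  rewrite !inE => /andP[/orP[//|/down_edgesP ei] /orP[//|/down_edgesP ej]].
  by move: ij; rewrite -ei -ej eqxx.
have [xyij|xyij] := eqVneq (x + u i) (y + u j).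
  apply: leq_trans (card_down_edges (x + u i)); apply: fsubset_leq_card.
  apply/fsubsetP => e; rewrite !inE -xyij.
  move=> /andP[/orP[/up_edgesP ex|//] /orP[/up_edgesP ey|//]].
  by move: xy; rewrite -ex -ey eqxx.
(* An edge touched by both paths joins an endpoint of one to the other. *)
have common e : e \in (step_edges x i `&` step_edges y j)%fset ->
    (e.1 = x /\ x + u e.2 = y + u j) \/ (e.1 = y /\ y + u e.2 = x + u i).
  rewrite !inE => /andP[/orP[/up_edgesP ex|/down_edgesP ex]
    /orP[/up_edgesP ey|/down_edgesP ey]].
  - by move: xy; rewrite -ex -ey eqxx.
  - by left; rewrite -ex.
  - by right; rewrite -ey.
  - by move: xyij; rewrite -ex -ey eqxx.
have [->|/fset0Pn[[v k] e0]] :=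
    eqVneq (step_edges x i `&` step_edges y j)%fset fset0.
  by rewrite cardfs0.
have -> : two_apart (x - y) && two_apart (x - y + step_diff (i, j)).
  have e1 : x - y + step_diff (i, j) = x + u i - (y + u j).
    by rewrite /step_diff /= opprD addrACA.
  have diff a b : x + u b = y + u a -> x - y = u a - u b.
    by move=> /(canRL (addrK _)) ->; rewrite addrAC [y + _]addrC addrK.
  rewrite e1; case: (common _ e0) => -[/= _ xk].
    apply/andP; split; apply/two_apartP.
      exists j, k; rewrite (diff _ _ xk); split=> //; apply: contra xy => /eqP jk.
      by rewrite -(inj_eq (@addIr _ (u j))) -xk jk.
    exists i, k; rewrite -xk opprD addrACA subrr add0r; split=> //.
    by apply: contra xyij => /eqP ->; rewrite xk.
  apply/andP; split; apply/two_apartP.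
    exists k, i; rewrite (diff _ _ (esym xk)); split=> //; apply: contra xy => /eqP jk.
    by rewrite -(inj_eq (@addIr _ (u i))) -xk jk.
  exists k, j; rewrite -xk opprD addrACA subrr add0r; split=> //.
  by apply: contra xyij => /eqP <-; rewrite xk.
suff : (step_edges x i `&` step_edges y j `<=` [fset (v, k)])%fset.
  by move=> /fsubset_leq_card; rewrite cardfs1.
apply/fsubsetP => -[v' k'] /common e'; rewrite inE.
(* Two such edges of opposite directions would force the paths to merge. *)
have merge a b : x + u a = y + u j -> y + u b = x + u i -> False.
  move=> xa yb.
  have : u a + u b = u j + u i.
    by apply: (@addrI _ (x + y)); rewrite addrACA xa yb addrACA [y + x]addrC.
  case/unit_vec_addI => -[aj bi].
    by move: xy; rewrite -(inj_eq (@addIr _ (u j))) -xa aj eqxx.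
  by move: xyij; rewrite -xa aj eqxx.
case: (common _ e0) e' => -[/= -> xk] [] [/= -> xk'].
- by rewrite -xk in xk'; move/addrI/unit_vec_inj: xk' => ->.
- by case: (merge _ _ xk xk').
- by case: (merge _ _ xk' xk).
- by rewrite -xk in xk'; move/addrI/unit_vec_inj: xk' => ->.
Qed.

Fixpoint path_cost z s t : nat :=
  match s, t with
  | i :: s', j :: t' =>
      (cost z (i, j) + path_cost (z + step_diff (i, j))%R s' t')%N
  | _, _ => d
  end.

Lemma height_step_edges x i e : e \in step_edges x i -> height e.1 = height x.
Proof.
rewrite inE => /orP[/up_edgesP -> //|/down_edgesP/(congr1 height)].
by rewrite !heightD !height_unit => /addIr.
Qed.

Lemma height_edges_above x s e :
  e \in edges_above x s -> height x <= height e.1.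
Proof.
elim: s x => [|i s ih] x /=; first by move=> /up_edgesP ->.
rewrite inE => /orP[/height_step_edges -> //|/ih].
by apply: le_trans; rewrite heightD height_unit lerDl.
Qed.

(** Edges of different layers are distinct, so that common edges can be
    counted layer by layer. *)
Lemma card_edges_aboveI x y s t : size s = size t -> height x = height y ->
  (#|` edges_above x s `&` edges_above y t|%fset <= path_cost (x - y)%R s t)%N.
Proof.
elim: s t x y => [|i s ih] [|j t] x y //= st xy.
  by apply: leq_trans (card_up_edges x); rewrite fsubset_leq_card // fsubsetIl.
have -> : x - y + step_diff (i, j) = x + u i - (y + u j).
  by rewrite /step_diff /= opprD addrACA.
have hi : height (x + u i) = height (y + u j).
  by rewrite !heightD !height_unit xy.
have {ih}/(_ hi) ih := ih t (x + u i) (y + u j) (succn_inj st).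
apply: leq_trans (leq_add (card_step_edgesI x y i j) ih).
rewrite -cardfsUI; apply: leq_trans (leq_addr _ _).
have layer x' x'' i' j' t' e : height x' = height x'' ->
    e \in step_edges x' i' -> e \in edges_above (x'' + u j') t' -> False.
  move=> xx /height_step_edges he /height_edges_above.
  by rewrite he heightD height_unit xx gerDl ler10.
apply: fsubset_leq_card; apply/fsubsetP => e.
move=> /fsetIP[/fsetUP[ex|ex] /fsetUP[ey|ey]];
  rewrite !in_fsetU !in_fsetI ?ex ?ey ?orbT //.
    by case: (layer _ _ _ _ _ _ xy ex ey).
by case: (layer _ _ _ _ _ _ (esym xy) ey ex).
Qed.

Lemma card_path_edgesI x s t : size s = size t ->
  (#|` path_edges x s `&` path_edges x t|%fset <= d + path_cost 0%R s t)%N.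
Proof.
move=> st; have := @card_edges_aboveI x x s t st erefl; rewrite subrr => le.
rewrite -fsetUIr; have := leq_add (card_down_edges x) le; apply: leq_trans.
by rewrite -cardfsUI leq_addr.
Qed.

End Edges.

(** * The weighted difference walk *)

Section Energy.
Variables (R : realType) (d : nat).
Hypothesis d_gt1 : (1 < d)%N.
Local Notation u := (@unit_vec d).
Implicit Types (z : lattice d) (p : 'I_d * 'I_d) (F G : 'I_d * 'I_d -> R).

Definition avg F : R := d%:R^-1 ^+ 2 * \sum_p F p.

Let d_neq0 : d%:R != 0 :> R. Proof. by rewrite pnatr_eq0; lia. Qed.

Let d_inv_ge0 : 0 <= d%:R^-1 ^+ 2 :> R.
Proof. by rewrite exprn_ge0 // invr_ge0. Qed.

Lemma ler_avg F G : (forall p, F p <= G p) -> avg F <= avg G.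
Proof. by move=> FG; rewrite ler_wpM2l // ler_sum. Qed.

Lemma avgD F G : avg (fun p => F p + G p) = avg F + avg G.
Proof. by rewrite /avg big_split mulrDr. Qed.

Lemma avgZ a F : avg (fun p => a * F p) = a * avg F.
Proof. by rewrite /avg -mulr_sumr mulrCA. Qed.

Lemma avg_cst a : avg (fun=> a) = a.
Proof.
rewrite /avg sumr_const card_prod card_ord -[X in _ * X]mulr_natr natrM.
by field.
Qed.

Lemma eq_avg F G : F =1 G -> avg F = avg G.
Proof. by move=> FG; rewrite /avg; congr (_ * _); apply: eq_bigr. Qed.

Lemma avg_ge0 F : (forall p, 0 <= F p) -> 0 <= avg F.
Proof. by move=> F0; rewrite mulr_ge0 // sumr_ge0. Qed.

Lemma avg_diag a b :
  avg (fun p => if p.1 == p.2 then a else b) = a / d%:R + (1 - d%:R^-1) * b.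
Proof.
have -> : avg (fun p => if p.1 == p.2 then a else b) =
          avg (fun p => b + (a - b) * (p.1 == p.2)%:R).
  by apply: eq_avg => p; case: ifP => _; rewrite ?mulr1 ?mulr0; lra.
rewrite avgD avg_cst avgZ.
have -> : avg (fun p => (p.1 == p.2)%:R) = d%:R^-1.
  rewrite /avg -(pair_bigA _ (fun i j => (i == j)%:R)) /=.
  under eq_bigr => i _.
    rewrite (bigD1 i) //= eqxx big1 ?addr0 => [|j /negbTE]; last first.
      by rewrite eq_sym => ->.
    over.
  by rewrite sumr_const card_ord mulr1n; field.
by field.
Qed.

(** For [z = u i - u j] the difference is undone only by the steps [j] and [i],
    since a sum of two unit vectors determines them up to order. *)
Lemma two_apart_meet z : two_apart z ->
  exists p1, forall p, (z + step_diff p == 0) = (p == p1).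
Proof.
move=> /two_apartP[i [j [ij ->]]]; exists (j, i) => -[k l].
rewrite /step_diff /= addrACA -opprD subr_eq0 xpair_eqE.
apply/idP/idP => [/eqP/unit_vec_addI|/andP[/eqP -> /eqP ->]]; last first.
  by rewrite addrC.
case=> [[e _]|[-> ->]]; last by rewrite !eqxx.
by rewrite e eqxx in ij.
Qed.

Lemma avg_meet z a : two_apart z ->
  avg (fun p => if z + step_diff p == 0 then a else 0) = d%:R^-1 ^+ 2 * a.
Proof.
move=> /two_apart_meet[p0 zp0]; rewrite /avg (bigD1 p0) //= zp0 eqxx.
by rewrite big1 ?addr0 // => p /negbTE; rewrite zp0 => ->.
Qed.

(** The probability that the walk of step law [step_diff] started at [z] is two
    apart at some time [0 <= k <= n]. *)
Fixpoint hit (n : nat) z : R :=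
  if two_apart z then 1
  else if n is m.+1 then avg (fun p => hit m (z + step_diff p)) else 0.

Lemma hit_two_apart n z : two_apart z -> hit n z = 1.
Proof. by case: n => [|n] /= ->. Qed.

Lemma hitS n z : ~~ two_apart z ->
  hit n.+1 z = avg (fun p => hit n (z + step_diff p)).
Proof. by move=> /negbTE /= ->. Qed.

Lemma hit_ge0 n z : 0 <= hit n z.
Proof.
by elim: n z => [|n ih] z /=; case: ifP => // _; apply: avg_ge0.
Qed.

Lemma hit_le n m z : (n <= m)%N -> hit n z <= hit m z.
Proof.
elim: n m z => [|n ih] m z nm.
  have [zz|/negbTE zz] := boolP (two_apart z); first by rewrite !hit_two_apart.
  by rewrite /= zz hit_ge0.
case: m nm => // m nm; have [zz|zz] := boolP (two_apart z).
  by rewrite !hit_two_apart.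
by rewrite !hitS //; apply: ler_avg => p; exact: ih.
Qed.

Lemma two_apart_step_diff p : two_apart (step_diff p) = (p.1 != p.2).
Proof.
apply/idP/idP => [/two_apart_neq0|pp]; first by rewrite step_diff_eq0.
by apply/two_apartP; exists p.1, p.2.
Qed.

Lemma hit0 n : hit n 0 = 1 - d%:R^-1 ^+ n.
Proof.
have z0 : ~~ two_apart (0 : lattice d).
  by apply/negP => /two_apart_neq0; rewrite eqxx.
elim: n => [|n ih]; first by rewrite /= (negbTE z0) subrr.
rewrite hitS //.
transitivity (avg (fun p => if p.1 == p.2 then 1 - d%:R^-1 ^+ n else 1)).
  apply: eq_avg => p; rewrite add0r; have [pp|pp] := eqVneq p.1 p.2.
    by have /eqP -> : step_diff p == 0; rewrite ?step_diff_eq0 ?pp.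
  by rewrite hit_two_apart // two_apart_step_diff.
by rewrite avg_diag exprS; field.
Qed.

(** The probability that the first step does not meet and that the walk is two
    apart at some time [1 <= k <= n + 1].  The first steps that meet are set
    apart because their excursion has another weight. *)
Definition avoid n z : R :=
  avg (fun p => if z + step_diff p == 0 then 0 else hit n (z + step_diff p)).

Lemma avg_hit n z : two_apart z ->
  avg (fun p => hit n (z + step_diff p)) =
  avoid n z + d%:R^-1 ^+ 2 * (1 - d%:R^-1 ^+ n).
Proof.
move=> zz; rewrite -(avg_meet _ zz) -avgD; apply: eq_avg => p.
by case: ifP => [/eqP ->|_]; rewrite ?add0r ?addr0 // hit0.
Qed.

Variable r : R.

(** The mean weight of [n] steps of two independent oriented walks at
    difference [z], where each common edge counted by [cost] is a factor [r]. *)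
Fixpoint energy (n : nat) z : R :=
  if n is m.+1 then avg (fun p => r ^+ cost z p * energy m (z + step_diff p))
  else 1.

Lemma sum_path_cost n z :
  \sum_(s <- words _ n) \sum_(t <- words _ n) r ^+ path_cost z s t =
  r ^+ d * (d%:R ^+ n) ^+ 2 * energy n z.
Proof.
elim: n z => [|n ih] z; first by rewrite !big_seq1 /= expr0 expr1n !mulr1.
rewrite big_words2_recl /= /avg mulrA.
have -> : r ^+ d * (d%:R ^+ n.+1) ^+ 2 * d%:R^-1 ^+ 2 =
          r ^+ d * (d%:R ^+ n) ^+ 2 by rewrite [d%:R ^+ n.+1]exprS; field.
rewrite mulr_sumr; apply: eq_bigr => p _; rewrite [RHS]mulrCA -ih mulr_sumr.
apply: eq_bigr => s _; rewrite mulr_sumr; apply: eq_bigr => t _.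
by rewrite /= exprD -surjective_pairing.
Qed.

Hypothesis r_ge1 : 1 <= r.
Variable alpha : R.
Hypothesis alpha_ge0 : 0 <= alpha.
Hypothesis avoid_le : forall n z, two_apart z -> avoid n z <= alpha.

Let sigma : R := r ^+ (2 * d - 1) / d%:R.
Let rho : R :=
  r * alpha + r ^+ (2 * d) * (1 - d%:R^-1) / (d%:R ^+ 2 * (1 - sigma)).

Hypothesis sigma_lt1 : sigma < 1.
Hypothesis rho_lt1 : rho < 1.

Let K : R := (1 - rho)^-1.
Let K0 : R := (1 - d%:R^-1) * r ^+ d * K / (1 - sigma).

(** A renewal argument: [rho] bounds the mean weight of an excursion between
    two times when the paths are two apart, so that [K], the sum of the
    geometric series of [rho], bounds the mean weight from such a time on.  An
    excursion that avoids the origin has weight at most [r], because it has a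
    common edge only if it consists of a single step; one through the origin
    pays [r ^+ d] for merging, [r ^+ (2 * d - 1)] for each common step and
    [r ^+ d] for splitting.  From the other vertices no weight is collected
    before the paths are two apart, which happens with probability [hit n z]. *)
Lemma energy_le n :
  (forall z, z != 0 -> energy n z <= 1 + (K - 1) * hit n z) /\
  energy n 0 <= K0.
Proof.
have r0 k : 1 <= r ^+ k by rewrite exprn_ege1.
have d1 : 0 <= 1 - d%:R^-1 :> R.
  by rewrite subr_ge0 invf_le1 ?ler1n ?ltr0n; lia.
have s1 : 0 < 1 - sigma by rewrite subr_gt0.
have rho0 : 0 <= rho.
  apply: addr_ge0; first by rewrite mulr_ge0 // (le_trans ler01).
  apply: mulr_ge0; first by rewrite mulr_ge0 // (le_trans ler01).
  by rewrite invr_ge0 mulr_ge0 ?exprn_ge0 // ltW.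
have rho1 : 0 < 1 - rho by rewrite subr_gt0.
have K1 : 1 <= K by rewrite invf_ge1 // gerBl.
have Krho : 1 + K * rho = K.
  by have := mulVf (lt0r_neq0 rho1); rewrite -/K mulrBr mulr1 => <-; rewrite subrK.
have s1' := lt0r_neq0 s1.
have sub_sigma : 1 - sigma <= 1 - d%:R^-1.
  by rewrite lerD2l lerN2 /sigma ler_peMl ?invr_ge0.
have K01 : 1 <= K0.
  rewrite /K0 ler_pdivlMr // mul1r; apply: le_trans sub_sigma _.
  by rewrite -mulrA ler_peMr // -[1]mulr1 ler_pM.
(* [K0] is the fixed point of the recursion at the origin, and [K] that of the
   recursion at two apart. *)
have K0E : K0 = sigma * K0 + (1 - d%:R^-1) * (r ^+ d * K).
  have -> : (1 - d%:R^-1) * (r ^+ d * K) = K0 * (1 - sigma).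
    by rewrite divfK // mulrA.
  by rewrite mulrBr mulr1 [sigma * _]mulrC addrC subrK.
have K0rho : d%:R^-1 ^+ 2 * (r ^+ d * K0) =
    K * (r ^+ (2 * d) * (1 - d%:R^-1) / (d%:R ^+ 2 * (1 - sigma))).
  rewrite mul2n -addnn exprD /K0; move: K (sigma) s1' => K' sigma' s1'.
  by field; rewrite s1' d_neq0.
have {}Krho : 1 + r * K * alpha + d%:R^-1 ^+ 2 * (r ^+ d * K0) = K.
  by rewrite K0rho -[RHS]Krho /rho; ring.
have rp : 0 < r by exact: lt_le_trans r_ge1.
move: K K0 K1 K01 K0E Krho {K0rho} => K' K0' K1 K01 K0E Krho.
have K'0 : 0 <= K' by exact: le_trans K1.
elim: n => [|n [ihz ih0]].
  by split=> // z _ /=; rewrite lerDl mulr_ge0 ?subr_ge0 //; case: ifP.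
have ih2 z : two_apart z -> energy n z <= K'.
  move=> zz; have := ihz _ (two_apart_neq0 zz).
  by rewrite hit_two_apart //; lra.
split=> [z z0|]; last first.
  rewrite /= K0E; have -> : sigma * K0' = (r ^+ (2 * d - 1) * K0') / d%:R.
    by rewrite /sigma mulrAC.
  rewrite -avg_diag; apply: ler_avg => p; rewrite /cost eqxx !add0r step_diff_eq0.
  have [pp|pp] := eqVneq p.1 p.2; rewrite ler_pM2l ?(lt_le_trans _ (r0 _)) //.
    by have /eqP -> : step_diff p == 0; rewrite ?step_diff_eq0 ?pp.
  by apply: ih2; rewrite two_apart_step_diff.
have [zz|zz] := boolP (two_apart z); last first.
  rewrite hitS //= -avgZ -[X in X + _]avg_cst -avgD; apply: ler_avg => p.
  have zp : z + step_diff p != 0.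
    apply: contra zz; rewrite addr_eq0 opprB => /eqP zE.
    by rewrite -[z]/(z) zE in z0 *; rewrite (two_apart_step_diff (p.2, p.1)) /=
       -(step_diff_eq0 (p.2, p.1)).
  by rewrite /cost (negbTE z0) (negbTE zp) (negbTE zz) mul1r; exact: ihz.
rewrite hit_two_apart // mulr1 addrC subrK /=.
suff : avg (fun p => r ^+ cost z p * energy n (z + step_diff p)) <=
    avg (fun p => 1 +
      (r * K' * (if z + step_diff p == 0 then 0 else hit n (z + step_diff p)) +
       (if z + step_diff p == 0 then r ^+ d * K0' else 0))).
  move=> /le_trans; apply.
  rewrite !avgD avg_cst avgZ avg_meet // -/(avoid n z).
  have : r * K' * avoid n z <= r * K' * alpha.
    by apply: ler_wpM2l (avoid_le n zz); rewrite mulr_ge0 // ltW.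
  lra.
apply: ler_avg => p; rewrite /cost (negbTE z0).
have [->|zp] := eqVneq (z + step_diff p) 0.
  rewrite mulr0 add0r; apply: ler_wpDl => //.
  by rewrite ler_pM2l ?(lt_le_trans _ (r0 _)).
rewrite addr0 zz /=; have [zzp|zzp] := boolP (two_apart _).
  rewrite hit_two_apart // mulr1; apply: ler_wpDl => //.
  by apply: ler_wpM2l (ih2 _ zzp); exact: ltW.
rewrite mul1r; apply: le_trans (ihz _ zp) _; rewrite lerD2l ler_wpM2r ?hit_ge0 //.
have : 1 * K' <= r * K' by rewrite ler_wpM2r.
lra.
Qed.

End Energy.

(** * The return probability *)

Section Symmetry.
Variables (R : realType) (d : nat).
Local Notation u := (@unit_vec d).
Local Notation hit := (@hit R d).

Lemma col_perm_unit (s : {perm 'I_d}) i : col_perm s (u i) = u ((s^-1)%g i).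
Proof.
apply/rowP => j; rewrite !mxE !eqxx /=; congr (nat_of_bool _)%:R.
by apply/eqP/eqP => [<-|->]; rewrite ?permK ?permKV.
Qed.

Lemma two_apart_perm (s : {perm 'I_d}) z :
  two_apart (col_perm s z) = two_apart z.
Proof.
suff main : forall (t : {perm 'I_d}) y, two_apart y -> two_apart (col_perm t y).
  apply/idP/idP => [/(main (s^-1)%g)|]; last exact: main.
  by rewrite -col_permM mulVg col_perm1.
move=> t y /two_apartP[i [j [ij ->]]]; apply/two_apartP.
exists ((t^-1)%g i), ((t^-1)%g j); split; first by rewrite (inj_eq perm_inj).
by rewrite !linearB /= !col_perm_unit.
Qed.

Lemma avg_col_perm (s : {perm 'I_d}) (F : lattice d -> R) z :
  avg (fun p => F (col_perm s z + step_diff p)) =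
  avg (fun p => F (col_perm s (z + step_diff p))).
Proof.
pose h t (p : 'I_d * 'I_d) := ((t : {perm 'I_d}) p.1, t p.2).
have hK : cancel (h (s^-1)%g) (h s).
  by move=> [i j]; rewrite /h /= !permKV.
have hKV : cancel (h s) (h (s^-1)%g).
  by move=> [i j]; rewrite /h /= !permK.
rewrite /avg; congr (_ * _); rewrite (reindex (h (s^-1)%g)) /=; last first.
  by exists (h s) => p _; [exact: hK|exact: hKV].
apply: eq_bigr => -[i j] _; congr F.
by rewrite linearD linearB /= !col_perm_unit.
Qed.

Lemma hit_perm n (s : {perm 'I_d}) z : hit n (col_perm s z) = hit n z.
Proof.
elim: n z => [|n ih] z /=; rewrite two_apart_perm //; case: ifP => // _.
by rewrite avg_col_perm; apply: eq_avg => p; exact: ih.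
Qed.

(** All pairs of vertices that are two apart look alike, up to a permutation of
    the coordinates. *)
Lemma avg_hit_sym n z z' : two_apart z -> two_apart z' ->
  avg (fun p => hit n (z + step_diff p)) = avg (fun p => hit n (z' + step_diff p)).
Proof.
move=> /two_apartP[a [b [ab ->]]] /two_apartP[a' [b' [ab' ->]]].
pose s : {perm 'I_d} := (tperm a a' * tperm (tperm a a' b) b')%g.
have sa : s a = a'.
  have ba : tperm a a' b != a'.
    by rewrite -[X in _ != X](tpermL a a') (inj_eq perm_inj) eq_sym.
  by rewrite permM tpermL (tpermD ba) // eq_sym.
have sb : s b = b' by rewrite permM tpermL.
have -> : u a - u b = col_perm s (u a' - u b').
  by rewrite linearB /= !col_perm_unit -sa -sb !permK.
by rewrite avg_col_perm; apply: eq_avg => p; exact: hit_perm.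
Qed.

End Symmetry.

Section Hits.
Variables (R : realType) (d : nat).
Hypothesis d_gt1 : (1 < d)%N.
Local Notation u := (@unit_vec d).

Fixpoint hits (z : lattice d) (s t : seq 'I_d) : bool :=
  two_apart z ||
  match s, t with
  | i :: s', j :: t' => hits (z + step_diff (i, j)) s' t'
  | _, _ => false
  end.

Lemma sum_hits n z :
  \sum_(s <- words _ n) \sum_(t <- words _ n) (hits z s t)%:R =
  (d%:R ^+ n) ^+ 2 * hit R n z.
Proof.
have [zz|zz] := boolP (two_apart z).
  rewrite hit_two_apart // mulr1.
  transitivity (\sum_(s <- words 'I_d n) \sum_(t <- words 'I_d n) (1 : R)).
    by apply: eq_bigr => s _; apply: eq_bigr => t _; case: s => *; rewrite /= zz.
  rewrite big_const_seq count_predT iter_addr_0 big_const_seq count_predT.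
  by rewrite iter_addr_0 -mulrnA size_words card_ord natrM natrX expr2.
elim: n z zz => [|n ih] z zz; first by rewrite !big_seq1 /= (negbTE zz) mulr0.
rewrite hitS // big_words2_recl /avg mulrA.
have -> : (d%:R ^+ n.+1) ^+ 2 * d%:R^-1 ^+ 2 = (d%:R ^+ n) ^+ 2 :> R.
  by rewrite [d%:R ^+ n.+1]exprS; field; rewrite pnatr_eq0; lia.
rewrite mulr_sumr; apply: eq_bigr => p _.
transitivity (\sum_(s <- words 'I_d n) \sum_(t <- words 'I_d n)
    (hits (z + step_diff p) s t)%:R : R).
  by apply: eq_bigr => s _; apply: eq_bigr => t _;
    rewrite /= (negbTE zz) -surjective_pairing.
have [zp|] := boolP (two_apart (z + step_diff p)); last exact: ih.
rewrite hit_two_apart // mulr1.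
transitivity (\sum_(s <- words 'I_d n) \sum_(t <- words 'I_d n) (1 : R)).
  by apply: eq_bigr => s _; apply: eq_bigr => t _; case: s => *; rewrite /= zp.
rewrite big_const_seq count_predT iter_addr_0 big_const_seq count_predT.
by rewrite iter_addr_0 -mulrnA size_words card_ord natrM natrX expr2.
Qed.

Definition displacement (s : seq 'I_d) : lattice d := \sum_(i <- s) u i.

Lemma hitsP z s t : size s = size t -> hits z s t ->
  exists2 k, (k <= size s)%N &
    two_apart (z + displacement (take k s) - displacement (take k t)).
Proof.
elim: s t z => [|i s ih] [|j t] z //=.
  by move=> _; rewrite orbF => zz; exists 0%N => //; rewrite /displacement
     !big_nil addr0 subr0.
move=> [st] /orP[zz|/(ih _ _ st)[k ks zk]].
  by exists 0%N => //; rewrite /displacement /= !big_nil addr0 subr0.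
exists k.+1 => //=; rewrite /displacement !big_cons -!/(displacement _).
by move: zk; rewrite /step_diff /= opprD !addrA; congr two_apart; rewrite -!addrA;
  congr (_ + (_ + _)); rewrite addrCA.
Qed.

Lemma l1_two_apart (z : lattice d) : two_apart z -> l1 z = 2%N.
Proof.
move=> /two_apartP[i [j [ij ->]]]; rewrite /l1 (bigD1 i) //= (bigD1 j) /=; last first.
  by rewrite eq_sym.
rewrite big1 => [|k /andP[ki kj]].
  by rewrite !mxE !eqxx /= (negbTE ij) eq_sym (negbTE ij).
by rewrite !mxE (negbTE ki) (negbTE kj).
Qed.

End Hits.

Section Walks.
Context {disp : measure_display} {T : measurableType disp} {R : realType}.
Variables (P : probability T R) (d : nat).
Hypothesis d_gt1 : (1 < d)%N.
Local Notation u := (@unit_vec d).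
Variables X X' : nat -> T -> lattice d.
Hypothesis hX : indep_walks P X X'.

Lemma discrete_random_element_op (Y Z : T -> lattice d)
    (f : lattice d -> lattice d -> lattice d) :
  discrete_random_element Y -> discrete_random_element Z ->
  discrete_random_element (fun t => f (Y t) (Z t)).
Proof.
move=> mY mZ A.
rewrite (_ : _ @^-1` A =
    \bigcup_y (Y @^-1` [set y] `&` Z @^-1` [set z | A (f y z)])).
  apply: countable_bigcupT_measurable; first exact: countableP.
  by move=> y; apply: measurableI.
by apply/seteqP; split=> t /=; [exists (Y t) | move=> [y _ [/= -> ]]].
Qed.

Lemma discrete_random_element_walk (Y : nat -> T -> lattice d) n :
  (forall k, discrete_random_element (Y k)) ->
  discrete_random_element (walk Y n).
Proof.
move=> mY; elim: n => [|n ih].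
  move=> A; have [A0|A0] := pselect (A 0).
    rewrite (_ : _ @^-1` A = setT) //; apply/seteqP; split=> t //= _.
    by rewrite /walk big_ord0.
  rewrite (_ : _ @^-1` A = set0) //; apply/seteqP; split=> t //=.
  by rewrite /walk big_ord0.
have := discrete_random_element_op +%R ih (mY n).
by congr discrete_random_element; apply/funext => t; rewrite /walk big_ord_recr.
Qed.

Definition apart_at n : set T := [set t | l1 (walk X n t - walk X' n t) = 2%N].

Lemma measurable_apart_at n : measurable (apart_at n).
Proof.
have [hx hx' _] := hX.
have := discrete_random_element_op (fun x y => x - y)
  (discrete_random_element_walk n (fun k => (hx k).1))
  (discrete_random_element_walk n (fun k => (hx' k).1)).
by move=> /(_ [set z | l1 z = 2%N]).
Qed.

Definition follow (s t : seq 'I_d) : set T :=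
  [set w | (forall k i, onth s k = Some i -> X k w = u i) /\
           (forall k i, onth t k = Some i -> X' k w = u i)].

Lemma follow_prob s t :
  measurable (follow s t) /\
  P (follow s t) = (d%:R^-1 ^+ (size s + size t))%:E.
Proof.
have [hx hx' ind] := hX.
pose Y (k : nat + nat) := match k with inl n => X n | inr n => X' n end.
pose A (k : nat + nat) : set (lattice d) := match k with
  | inl k => [set x | forall i, onth s k = Some i -> x = u i]
  | inr k => [set x | forall i, onth t k = Some i -> x = u i] end.
pose l := map inl (iota 0 (size s)) ++ map inr (iota 0 (size t)) : seq (nat + nat).
have mY k : discrete_random_element (Y k).
  by case: k => k; [exact: (hx k).1|exact: (hx' k).1].
have inlE k : (inl k \in l) = (k < size s)%N.
  rewrite mem_cat mem_map; last by move=> ? ? [].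
  rewrite mem_iota add0n /= (negbTE (_ : _ \notin _)) ?orbF //.
  by apply/mapP => -[].
have inrE k : (inr k \in l) = (k < size t)%N.
  rewrite mem_cat orbC mem_map; last by move=> ? ? [].
  rewrite mem_iota add0n /= (negbTE (_ : _ \notin _)) ?orbF //.
  by apply/mapP => -[].
have fE : follow s t = [set w | forall k, k \in l -> A k (Y k w)].
  apply/seteqP; split=> w /=.
    move=> [hs ht] [k|k] _ i /=; [exact: hs|exact: ht].
  move=> h; split=> k i ki.
    by have := h (inl k); rewrite inlE -onthTE ki => /(_ isT i ki).
  by have := h (inr k); rewrite inrE -onthTE ki => /(_ isT i ki).
have ul : uniq l.
  rewrite cat_uniq !map_inj_uniq ?iota_uniq /= ?andbT //; try by move=> ? ? [].
  by apply/hasPn => _ /mapP[k _ ->]; apply/mapP => -[].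
split.
  rewrite fE (_ : [set w | _] = \bigcap_(k in [set` l]) (Y k @^-1` A k)) //.
  by apply: fin_bigcap_measurable => // k _; exact: mY.
rewrite fE; apply: etrans (ind l A ul) _; congr (_%:E).
have prob_word (Z : nat -> T -> lattice d) (v : seq 'I_d) :
    (forall n, uniform_step P (Z n)) ->
    \prod_(k <- iota 0 (size v))
      fine (P (Z k @^-1` [set x | forall i, onth v k = Some i -> x = u i])) =
    d%:R^-1 ^+ size v.
  move=> hZ; rewrite -[in RHS](subn0 (size v)) -prodr_const_nat /index_iota subn0.
  apply: eq_big_seq => k; rewrite mem_iota add0n /= -onthTE.
  case vk : (onth v k) => [i|] // _.
  rewrite (_ : [set x | _] = [set u i]) ?(hZ k).2 //.
  by apply/seteqP; split=> x /=; [exact|move=> -> j [->]].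
by rewrite big_cat !big_map exprD; congr (_ * _); exact: prob_word.
Qed.

Lemma walk_word (Y : nat -> T -> lattice d) w s k :
  (forall m i, onth s m = Some i -> Y m w = u i) -> (k <= size s)%N ->
  walk Y k w = displacement (take k s).
Proof.
move=> Ys; elim: k => [|k ih] ks.
  by rewrite /walk big_ord0 take0 /displacement big_nil.
rewrite /walk big_ord_recr /= -/(walk Y k w) ih; last exact: ltnW.
have : onth s k by rewrite onthTE.
case sk : (onth s k) => [i|] // _; rewrite (Ys _ _ sk).
have i0 := i; rewrite (take_nth i0) // /displacement -cats1 big_cat big_seq1.
by rewrite (onth_nth i0 _ _ _ sk).
Qed.

(** The intersection of the two events in [p2], up to a finite horizon and read
    on the words of steps. *)
Definition returning (s t : seq 'I_d) : bool :=
  match s, t with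
  | a :: i :: s', b :: j :: t' =>
      (a != b) && hits (step_diff (a, b) + step_diff (i, j)) s' t'
  | _, _ => false
  end.

Lemma sum_returning n (z : lattice d) : two_apart z ->
  \sum_(s <- words _ n.+2) \sum_(t <- words _ n.+2) (returning s t)%:R =
  d%:R ^+ (n.+2 + n.+2) * (1 - d%:R^-1) *
    avg (fun p => hit R n (z + step_diff p)) :> R.
Proof.
have dn0 : d%:R != 0 :> R by rewrite pnatr_eq0; lia.
move=> zz; set G := avg _.
rewrite big_words2_recl.
transitivity (\sum_(p : 'I_d * 'I_d)
    (d%:R ^+ n.+1) ^+ 2 * (if p.1 == p.2 then 0 else G)).
  apply: eq_bigr => p _; rewrite big_words2_recl.
  transitivity (\sum_(q : 'I_d * 'I_d) (p.1 != p.2)%:R *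
      ((d%:R ^+ n) ^+ 2 * hit R n (step_diff p + step_diff q))).
    apply: eq_bigr => q _; rewrite -sum_hits // mulr_sumr.
    apply: eq_bigr => s _; rewrite mulr_sumr; apply: eq_bigr => t _ /=.
    by rewrite -!surjective_pairing -natrM mulnb.
  rewrite -!mulr_sumr; have [pp|pp] := eqVneq p.1 p.2.
    by rewrite mul0r mulr0.
  have <- : avg (fun q => hit R n (step_diff p + step_diff q)) = G.
    by apply: avg_hit_sym; rewrite ?two_apart_step_diff.
  by rewrite /avg [d%:R ^+ n.+1]exprS mul1r; field.
rewrite -mulr_sumr -[\sum_p _](mulKf (expf_neq0 2 (invr_neq0 dn0))) -/(avg _).
rewrite avg_diag // mul0r add0r.
have -> : d%:R ^+ (n.+2 + n.+2) = (d%:R ^+ n.+1) ^+ 2 * d%:R ^+ 2 :> R.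
  by rewrite -exprM -exprD; congr (_ ^+ _); lia.
by field.
Qed.

(** Given that they are two apart after one step, the difference of the walks
    is uniform over all differences of two distinct unit vectors, and by
    symmetry the return probability from each of them is the same. *)
Lemma le_p2 n (z : lattice d) : two_apart z ->
  avg (fun p => hit R n (z + step_diff p)) <= p2 P X X'.
Proof.
move=> zz; have dn0 : d%:R != 0 :> R by rewrite pnatr_eq0; lia.
have G0 : 0 <= avg (fun p => hit R n (z + step_diff p)).
  by apply: avg_ge0 => p; exact: hit_ge0.
pose B := apart_at 1; pose A := \bigcup_(k in [set k | (2 <= k)%N]) apart_at k.
have mB : measurable B by exact: measurable_apart_at.
have mA : measurable A.
  by apply: bigcup_measurable => k _; exact: measurable_apart_at.
pose W m := [seq (s, t) | s <- words 'I_d m, t <- words 'I_d m].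
have Wsz m st : st \in W m -> size st.1 = m /\ size st.2 = m.
  case/allpairsP => -[s t] /= [+ + ->] /=; rewrite !mem_words.
  by move=> /eqP -> /eqP ->.
have Wuniq m : uniq (W m).
  by apply: allpairs_uniq; rewrite ?words_uniq // => -[? ?] [? ?].
have disj m st st' t : st \in W m -> st' \in W m ->
    follow st.1 st.2 t -> follow st'.1 st'.2 t -> st = st'.
  case: st st' => [s1 s2] [s1' s2'] /Wsz[/= e1 e2] /Wsz[/= e1' e2'].
  move=> [h1 h2] [h1' h2'].
  have eqw (Y : nat -> T -> lattice d) v v' : size v = size v' ->
      (forall k i, onth v k = Some i -> Y k t = u i) ->
      (forall k i, onth v' k = Some i -> Y k t = u i) -> v = v'.
    move=> vv h h'; apply: eq_from_onth => k.
    have := onthTE v k; have := onthTE v' k; rewrite vv => <-.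
    case vk : (onth v k) => [i|]; case vk' : (onth v' k) => [i'|] // _.
    by congr Some; apply: (@unit_vec_inj d); rewrite -(h _ _ vk) (h' _ _ vk').
  by rewrite (eqw X s1 s1') ?e1 // (eqw X' s2 s2') ?e2.
have lower : (1 - d%:R^-1) * avg (fun p => hit R n (z + step_diff p)) <=
             fine (P (A `&` B)).
  pose r := [seq st <- W n.+2 | returning st.1 st.2].
  have := @le_prob_disjoint _ _ _ P _ r (fun st => follow st.1 st.2) (A `&` B).
  have -> : \sum_(st <- r) fine (P (follow st.1 st.2)) =
      (1 - d%:R^-1) * avg (fun p => hit R n (z + step_diff p)).
    transitivity (\sum_(st <- W n.+2)
        (returning st.1 st.2)%:R * d%:R^-1 ^+ (n.+2 + n.+2) : R).
      rewrite big_filter big_mkcond; apply: eq_big_seq => st /Wsz[s1 s2].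
      by rewrite (follow_prob _ _).2 s1 s2; case: ifP; rewrite ?mul1r ?mul0r.
    rewrite -mulr_suml big_allpairs /= (sum_returning n zz) exprVn.
    have := expf_neq0 (n.+2 + n.+2) dn0; move: (d%:R ^+ (n.+2 + n.+2)) => D D0.
    by field; rewrite dn0 D0.
  apply.
  - by rewrite filter_uniq.
  - by move=> st; exact: (follow_prob _ _).1.
  - exact: measurableI.
  - move=> st st' t; rewrite !mem_filter => /andP[_ sW] /andP[_ sW'].
    exact: disj sW sW'.
  - case=> s t; rewrite mem_filter /= => /andP[].
    case: s t => [|a [|i s]] // [|b [|j t]] // /andP[ab hst] /Wsz[/= [ss] [ts]].
    move=> w [hs ht]; split.
      have [|k ks zk] := hitsP _ hst; first by rewrite ss ts.
      exists k.+2 => //=; rewrite /apart_at /=.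
      rewrite (walk_word hs) /=; last by rewrite !ltnS.
      rewrite (walk_word ht) /=; last by rewrite !ltnS ts -ss.
      rewrite /displacement !big_cons -!/(displacement _); apply: l1_two_apart.
      suff -> : u a + (u i + displacement (take k s)) -
          (u b + (u j + displacement (take k t))) = step_diff (a, b) +
          step_diff (i, j) + displacement (take k s) - displacement (take k t).
        by [].
      by apply/rowP => m; rewrite /step_diff !mxE; ring.
    rewrite /B /apart_at /= (walk_word hs) // (walk_word ht) //=.
    rewrite /displacement ?take0 !big_seq1; apply: l1_two_apart.
    by rewrite (two_apart_step_diff (a, b)).
have upper : fine (P B) <= 1 - d%:R^-1.
  have mBc : measurable (~` B) by exact: measurableC.
  have PBc : fine (P (~` B)) = 1 - fine (P B).
    rewrite probability_setC // fineB //; exact: fin_num_measure.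
  suff : d%:R^-1 <= fine (P (~` B)) by rewrite PBc; lra.
  have := @le_prob_disjoint _ _ _ P _ [seq ([:: a], [:: a]) | a <- enum 'I_d]
    (fun st => follow st.1 st.2) (~` B).
  rewrite big_map big_enum /=.
  under eq_bigr do rewrite (follow_prob _ _).2 /=.
  rewrite sumr_const card_ord -[X in X <= _]mulr_natr.
  have -> : d%:R^-1 ^+ (1 + 1) * d%:R = d%:R^-1 :> R by field.
  apply => //.
  - by rewrite map_inj_uniq ?enum_uniq // => a b [].
  - by move=> st; exact: (follow_prob _ _).1.
  - move=> st st' t /mapP[a _ ->] /mapP[b _ ->].
    by apply: (disj 1%N); apply/allpairsP;
      [exists ([:: a], [:: a])|exists ([:: b], [:: b])]; rewrite !mem_words.
  - move=> st /mapP[a _ ->] w [hs ht]; rewrite /B /apart_at /=.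
    rewrite (walk_word hs) // (walk_word ht) // subrr.
    by rewrite /l1 big1 // => i _; rewrite mxE.
rewrite [p2 _ _ _](_ : _ = fine (P (A `&` B)) / fine (P B)) //.
have := fine_ge0 (measure_ge0 P B); rewrite le_eqVlt => /orP[/eqP PB0|PB].
  rewrite -PB0 invr0 mulr0; move: lower.
  have -> : fine (P (A `&` B)) = 0.
    apply/eqP; rewrite eq_le fine_ge0 // andbT [X in _ <= X]PB0.
    have mAB : measurable (A `&` B) by exact: measurableI.
    apply: fine_le; rewrite ?fin_num_measure //.
    by apply: le_measure; [exact: mem_set|exact: mem_set|exact: subIsetr].
  by rewrite pmulr_rle0 // subr_gt0 invf_lt1 ?ltr1n ?ltr0n //; lia.
rewrite ler_pdivlMr //; apply: le_trans lower; rewrite mulrC.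
by rewrite ler_wpM2r.
Qed.

End Walks.

(** * Infinite shielded paths *)

Section Koenig.
Variables (A : finType) (Q : seq A -> Prop).
Hypothesis Q_rcons : forall s a, Q (rcons s a) -> Q s.

Lemma prefix_closed s t : Q (s ++ t) -> Q s.
Proof.
elim/last_ind: t => [|t a ih]; first by rewrite cats0.
by rewrite -rcons_cat => /Q_rcons.
Qed.

(** Koenig's lemma, for the tree of the words that satisfy [Q]: as the alphabet
    is finite, a word with arbitrarily long extensions in the tree has a
    one-letter extension with this property. *)
Lemma koenig : (forall n, exists2 s, size s = n & Q s) ->
  exists f : nat -> A, forall n, Q (mkseq f n).
Proof.
move=> Qn; pose good s := forall n, exists2 t, size t = n & Q (s ++ t).
have [[|a0 s0] // _ _] := Qn 1%N.
have /choice[next nextP] s : exists a, good s -> good (rcons s a).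
  have [gs|ngs] := pselect (good s); last by exists a0 => /ngs.
  have [//|nex] := pselect (exists a, good s -> good (rcons s a)).
  have /choice[N hN] a : exists n, forall t, size t = n -> ~ Q (rcons s a ++ t).
    apply: contrapT => nN; apply: nex; exists a => _ n; apply: contrapT => h.
    by apply: nN; exists n => t tn Qt; apply: h; exists t.
  have [[|a t] //= [tN] Qt] := gs (\max_a N a).+1.
  case: (hN a (take (N a) t)).
    by rewrite size_takel // tN; exact: leq_bigmax.
  by apply: (@prefix_closed _ (drop (N a) t)); rewrite -catA cat_take_drop cat_rcons.
pose S := fix S n := if n is m.+1 then rcons (S m) (next (S m)) else [::].
have goodS n : good (S n) by elim: n => [n|n ih] /=; [exact: Qn|exact: nextP].
exists (fun n => next (S n)) => n.
have -> : mkseq (fun n => next (S n)) n = S n.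
  by elim: n => // n ih; rewrite mkseqS ih.
by have [t /size0nil -> +] := goodS n 0%N; rewrite cats0.
Qed.

End Koenig.

Section Shielding.
Variable d : nat.
Local Notation u := (@unit_vec d).
Implicit Types (w : config d) (x : lattice d) (s : seq 'I_d).

Definition all_closed (E : {fset edge d}) : set (config d) :=
  [set w | forall e, e \in E -> w e = false].

Lemma shieldedP w x : shielded w x <-> all_closed (path_edges x [::]) w.
Proof.
split=> [sh e|cl e [y]].
  rewrite in_fsetU => /orP[/down_edgesP|/up_edgesP] ex; apply: sh.
    by exists e.1; right.
  by exists (e.1 + u e.2); left.
case=> [[xE _]|[_ xE]]; apply: cl; rewrite in_fsetU; apply/orP.
  by right; apply/up_edgesP.
by left; apply/down_edgesP.
Qed.

Lemma all_closedS (E F : {fset edge d}) :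
  (E `<=` F)%fset -> all_closed F `<=` all_closed E.
Proof. by move=> /fsubsetP EF w h e /EF/h. Qed.

Lemma shielded_last w x s :
  all_closed (path_edges x s) w -> shielded w (x + displacement s).
Proof.
elim: s x => [|i s ih] x.
  by move=> /shieldedP; rewrite /displacement big_nil addr0.
rewrite /displacement big_cons addrA -/(displacement s) => cl; apply: ih.
apply: all_closedS cl; apply/fsubsetP => e; rewrite !in_fsetU.
by case/orP => ->; rewrite ?orbT.
Qed.

Lemma path_edges_rcons x s a :
  (path_edges x s `<=` path_edges x (rcons s a))%fset.
Proof.
apply: fsetUS; elim: s x => [|i s ih] x /=; last exact: fsetUS.
by apply/fsubsetP => e ex; rewrite !in_fsetU ex.
Qed.

(** By compactness, arbitrarily long shielded oriented paths from the origin
    give an infinite one; its vertices are distinct as they have distinct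
    heights. *)
Lemma long_paths_percolate w :
  (forall n, exists2 s, size s = n & all_closed (path_edges 0 s) w) ->
  shield_percolates w.
Proof.
move=> h; have [|f fP] := koenig _ h.
  by move=> s a; apply: all_closedS; exact: path_edges_rcons.
pose v n := displacement (mkseq f n).
have vS n : v n.+1 = v n + u (f n).
  by rewrite /v /displacement mkseqS -cats1 big_cat big_seq1.
exists v, (fun n => (v n, f n)); split.
- by move=> n; left.
- have hv n : height (v n) = n%:Z.
    elim: n => [|n ih]; last by rewrite vS heightD ih height_unit -PoszD addn1.
    by rewrite /v /displacement big_nil /height big1 // => i _; rewrite mxE.
  by move=> m n /(congr1 (@height d)); rewrite !hv => -[].
- by move=> n; have /shielded_last := fP n; rewrite add0r.
Qed.

Lemma measurable_all_closed E : measurable (all_closed E).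
Proof.
rewrite (_ : all_closed E =
  \bigcap_(e in [set` E]) [set w : config d | w e = false]) //.
apply: fin_bigcap_measurable => [|e _]; first exact: finite_fset.
by apply: sub_sigma_algebra; exists e, false.
Qed.

Lemma measurable_shielded x : measurable [set w : config d | shielded w x].
Proof.
rewrite (_ : [set w | _] = all_closed (path_edges x [::])).
  exact: measurable_all_closed.
by apply/seteqP; split=> w /shieldedP.
Qed.

Definition signed_step (a : 'I_d * bool) : lattice d :=
  if a.2 then u a.1 else - u a.1.

Definition place x (s : seq ('I_d * bool)) : lattice d :=
  x + \sum_(a <- s) signed_step a.

Definition self_avoiding x (s : seq ('I_d * bool)) : Prop :=
  forall j k, (j < k <= size s)%N ->
  place x (take j s) <> place x (take k s).

Definition shielded_word w x (s : seq ('I_d * bool)) : Prop :=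
  (forall k, (k <= size s)%N -> shielded w (place x (take k s))) /\
  self_avoiding x s.

Lemma shield_percolatesP w : shield_percolates w <->
  exists x, forall n, exists2 s, size s = n & shielded_word w x s.
Proof.
have takeS (f : nat -> 'I_d * bool) k n : (k <= n)%N ->
    take k (mkseq f n) = mkseq f k.
  by move=> kn; rewrite /mkseq -map_take take_iota (minn_idPl kn).
have placeS x f n : place x (mkseq f n.+1) =
    place x (mkseq f n) + signed_step (f n).
  by rewrite /place mkseqS -cats1 big_cat big_seq1 addrA.
have place0 x f : place x (mkseq f 0) = x by rewrite /place big_nil addr0.
split=> [[v [e [ve vI sh]]]|[x hx]].
  have /choice[f fP] n : exists a, v n.+1 = v n + signed_step a.
    have [[vn vn1]|[vn1 vn]] := ve n.
      by exists ((e n).2, true); rewrite /signed_step /= vn vn1.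
    by exists ((e n).2, false); rewrite /signed_step /= vn vn1 addrK.
  have placev n : place (v 0%N) (mkseq f n) = v n.
    by elim: n => [|n ih]; rewrite ?place0 // placeS ih fP.
  exists (v 0%N) => n; exists (mkseq f n); first by rewrite size_mkseq.
  split=> [k|j k]; rewrite size_mkseq => kn.
    by rewrite takeS // placev; exact: sh.
  case/andP: kn => jk kn; rewrite !takeS //; last by rewrite ltnW ?(leq_trans jk).
  by rewrite !placev => /vI jkE; rewrite jkE ltnn in jk.
have [|f fP] := koenig _ hx.
  move=> s a; rewrite /shielded_word /self_avoiding size_rcons -cats1.
  move=> [sh sa]; split=> [k ks|j k /andP[jk ks]].
    by have := sh k (leqW ks); rewrite takel_cat.
  have := sa j k; rewrite jk leqW // => /(_ isT).
  by rewrite !takel_cat // (leq_trans (ltnW jk)).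
pose v n := place x (mkseq f n).
exists v, (fun n => (if (f n).2 then v n else v n.+1, (f n).1)); split.
- move=> n; rewrite /v /joins /= placeS /signed_step.
  by case: (f n).2; [left|right]; rewrite ?subrK.
- have vneq j k : (j < k)%N -> v j <> v k.
    move=> jk; have [_ /(_ j k)] := fP k; rewrite size_mkseq jk leqnn.
    by rewrite !takeS ?(ltnW jk) // => /(_ isT).
  by move=> j k vjk; case: (ltngtP j k) => // /vneq; rewrite vjk.
- move=> n; have [/(_ n) + _] := fP n.
  by rewrite size_mkseq leqnn takeS // => /(_ isT).
Qed.

(** By Koenig's lemma, an infinite shielded path from a given vertex exists as
    soon as finite self-avoiding ones of all lengths do, and these are countably
    many events on finitely many edges. *)
Lemma measurable_shield_percolates : measurable (@shield_percolates d).
Proof.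
rewrite (_ : @shield_percolates d = \bigcup_x \bigcap_n \bigcup_s
    (if size s == n then [set w | shielded_word w x s] else set0)).
  apply: countable_bigcupT_measurable => [|x]; first exact: countableP.
  apply: bigcapT_measurable => n.
  apply: countable_bigcupT_measurable => [|s]; first exact: countableP.
  case: ifP => // _; have [sa|nsa] := pselect (self_avoiding x s); last first.
    rewrite (_ : [set w | _] = set0) //.
    by apply/seteqP; split=> w // [].
  rewrite (_ : [set w | _] = \bigcap_(k in [set k | (k <= size s)%N])
      [set w : config d | shielded w (place x (take k s))]).
    by apply: bigcap_measurableType => k _; exact: measurable_shielded.
  by apply/seteqP; split=> w /= => [[]|].
apply/seteqP; split=> w.
  move=> /shield_percolatesP[x hx]; exists x => // n _.
  by have [s sn hs] := hx n; exists s => //; rewrite sn eqxx.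
move=> [x _ hx]; apply/shield_percolatesP; exists x => n.
by have [s _] := hx n I; case: eqP => // sn; exists s.
Qed.

End Shielding.

(** * Percolation of shielded vertices *)

Section Percolation.
Variables (R : realType) (d : nat) (p : R).
Variable P : probability (config d) R.
Hypothesis hP : is_percolation_measure p P.
Local Notation r := ((1 - p)^-1).

Lemma all_closed_prob (E : {fset edge d}) :
  fine (P (all_closed E)) = (1 - p) ^+ #|` E|.
Proof.
have [ind openP] := hP.
rewrite [P _](ind (enum_fset E) (fun=> [set false]) (fset_uniq E)) /=.
rewrite (eq_bigr (fun=> 1 - p)) => [|e _]; first by
  rewrite big_const_seq count_predT iter_mulr_1.
rewrite (_ : _ @^-1` _ = ~` [set w : config d | w e = true]).
  by rewrite probability_setC ?openP //; apply: sub_sigma_algebra; exists e, true.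
by apply/seteqP; split=> w /=; case: (w e).
Qed.

Definition shielded_to n : set (config d) :=
  \bigcup_(s in [set` words 'I_d n]) all_closed (path_edges 0 s).

Hypotheses (d_gt1 : (1 < d)%N) (p_ge0 : 0 <= p) (q_gt0 : 0 < 1 - p).

(** Each path is weighted by the inverse of its probability, which turns the
    second moment into the mean of [r] to the number of common edges. *)
Lemma shielded_to_prob C n : 0 < C -> energy r n (0 : lattice d) <= C ->
  (r ^+ d * r ^+ d * C)^-1 <= fine (P (shielded_to n)).
Proof.
move=> C0 leC.
have r0 : 0 < r by rewrite invr_gt0.
have q0 k : (1 - p) ^+ k != 0 by rewrite expf_neq0 // gt_eqF.
have rq k : r ^+ k * (1 - p) ^+ k = 1 by rewrite exprVn mulVf.
pose c s := r ^+ #|` path_edges (0 : lattice d) s|.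
have c1 s : c s * fine (P (all_closed (path_edges 0 s))) = 1.
  by rewrite all_closed_prob rq.
have sum1 : \sum_(s <- words 'I_d n) c s * fine (P (all_closed (path_edges 0 s)))
    = d%:R ^+ n.
  under eq_bigr do rewrite c1.
  by rewrite big_const_seq count_predT iter_addr_0 size_words card_ord natrX.
apply: (second_moment (c := c)).
- by move=> s; rewrite exprn_ge0 // ltW.
- by move=> s; exact: measurable_all_closed.
- by rewrite !mulr_gt0 ?exprn_gt0.
- by rewrite sum1 exprn_gt0 // ltr0n; lia.
rewrite sum1.
apply: (@le_trans _ _ (r ^+ d *
    (r ^+ d * (d%:R ^+ n) ^+ 2 * energy r n (0 : lattice d)))); last first.
  rewrite [leRHS](_ : _ = r ^+ d * (r ^+ d * (d%:R ^+ n) ^+ 2 * C)); last by ring.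
  by rewrite !ler_wpM2l ?mulr_ge0 ?exprn_ge0 // ltW.
rewrite -sum_path_cost // mulr_sumr big_seq [leRHS]big_seq.
apply: ler_sum => s /[!mem_words] /eqP sn; rewrite mulr_sumr big_seq [leRHS]big_seq.
apply: ler_sum => t /[!mem_words] /eqP tn.
have -> : all_closed (path_edges 0 s) `&` all_closed (path_edges 0 t) =
          all_closed (path_edges 0 s `|` path_edges 0 t)%fset.
  apply/seteqP; split=> w; first by move=> [hs ht] e /fsetUP[/hs|/ht].
  by move=> h; split=> e he; apply: h; apply/fsetUP; [left|right].
rewrite all_closed_prob /c -exprD -cardfsUI addnC exprD -mulrA rq mulr1.
rewrite -exprD; apply: ler_weXn2l; last by apply: card_path_edgesI; rewrite sn.
by rewrite invf_ge1 // gerBl.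
Qed.

(** The events [shielded_to n] decrease, so that a positive lower bound on their
    probabilities holds for their intersection. *)
Lemma percolates C : (forall n, energy r n (0 : lattice d) <= C) ->
  (0 < P (@shield_percolates d))%E.
Proof.
move=> leC; have C0 : 0 < C by exact: lt_le_trans (leC 0%N).
set eps := (r ^+ d * r ^+ d * C)^-1.
have eps0 : 0 < eps.
  by rewrite invr_gt0 !mulr_gt0 ?exprn_gt0 // invr_gt0.
have mU n : measurable (shielded_to n).
  apply: fin_bigcup_measurable => // s _; exact: measurable_all_closed.
have anti : {homo shielded_to : n m / (n <= m)%N >-> (m <= n)%O}.
  apply/nonincreasing_seqP => n; apply/subsetPset => w [s ws cl].
  have {ws} : size s == n.+1 by rewrite -mem_words.
  case/lastP: s cl => [//|s a] cl; rewrite size_rcons eqSS => sn.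
  exists s; first by rewrite /= mem_words.
  exact: all_closedS (path_edges_rcons _ _ _) _ cl.
have mI : measurable (\bigcap_n shielded_to n) by exact: bigcapT_measurable.
have lim : (P \o shielded_to) n @[n --> \oo] --> P (\bigcap_n shielded_to n).
  apply: nonincreasing_cvg_mu => //.
  by apply: le_lt_trans (probability_le1 P (mU 0%N)) _; rewrite ltry.
have : (eps%:E <= P (\bigcap_n shielded_to n))%E.
  rewrite -(cvg_lim _ lim) //; apply: lime_ge; first exact: cvgP lim.
  apply: nearW => n /=; rewrite -[P _]fineK ?fin_num_measure // lee_fin.
  exact: shielded_to_prob.
move=> /(lt_le_trans _) h; apply: (@lt_le_trans _ _ (P (\bigcap_n shielded_to n))).
  by apply: h; rewrite lte_fin.
apply: le_measure; first exact: mem_set.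
  by apply: mem_set; exact: measurable_shield_percolates.
move=> w hw; apply: long_paths_percolate => n.
have [s ws cl] := hw n I; exists s => //.
by apply/eqP; rewrite -mem_words.
Qed.

End Percolation.

(** * Conclusion *)

Section Conclusion.
Variables (R : realType) (d : nat).
Hypothesis d_gt1 : (1 < d)%N.
Context {disp : measure_display} {T : measurableType disp}.
Variables (P : probability T R) (X X' : nat -> T -> lattice d).
Hypothesis hX : indep_walks P X X'.

Lemma d_inv_lt1 : d%:R^-1 < 1 :> R.
Proof. by rewrite invf_lt1 ?ltr1n ?ltr0n //; lia. Qed.

(** The event of [p2] includes the walks that merge in the second step, which
    has probability [1 / d ^ 2]: they almost surely separate again, and are then
    two apart.  At horizon [m] this costs an error [1 / d ^ (m + 2)]. *)
Lemma avoid_le_p2 n (z : lattice d) : two_apart z ->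
  avoid R n z <= p2 P X X' - d%:R^-1 ^+ 2.
Proof.
move=> zz; rewrite lerBrDr.
have avoid_mono m : (n <= m)%N -> avoid R n z <= avoid R m z.
  by move=> nm; apply: ler_avg => q; case: ifP => // _; exact: hit_le.
apply/ler_addgt0Pr => e e0.
have di0 : 0 <= d%:R^-1 :> R by [].
have /cvgrPdist_lt/(_ _ e0)[N _ hN] : (fun n => d%:R^-1 ^+ n : R) @ \oo --> (0 : R).
  by apply: cvg_expr; rewrite ger0_norm // d_inv_lt1.
pose m := maxn n N; have := hN m (leq_maxr _ _); rewrite /= sub0r normrN.
rewrite ger0_norm ?exprn_ge0 // => dm.
have := le_p2 d_gt1 hX m zz; rewrite avg_hit // mulrBr mulr1.
have := avoid_mono m (leq_maxl _ _).
have : d%:R^-1 ^+ 2 * d%:R^-1 ^+ m <= 1 * e.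
  by apply: ler_pM => //; rewrite ?exprn_ge0 ?exprn_ile1 // ltW // d_inv_lt1.
lra.
Qed.

Lemma p2_ge : 0 <= p2 P X X' - d%:R^-1 ^+ 2.
Proof.
pose i0 : 'I_d := Ordinal (ltnW d_gt1); pose i1 : 'I_d := Ordinal d_gt1.
have zz : two_apart (step_diff (i0, i1)) by rewrite two_apart_step_diff.
apply: le_trans (avoid_le_p2 0 zz); apply: avg_ge0 => q.
by case: ifP => // _; exact: hit_ge0.
Qed.

End Conclusion.


Theorem theorem1p2 (R : realType) (d : nat) (hd : (4 <= d)%N) (p : R)
    (hp : 0 <= p <= 1)
    (disp : measure_display) (T : measurableType disp) (P : probability T R)
    (X X' : nat -> T -> lattice d) (hX : indep_walks P X X')
    (h1 : p < 1 - (1 / d%:R) `^ (1 / (2 * d%:R - 1)))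
    (h2 : 1 / (1 - p) *
          (p2 P X X' - 1 / d%:R ^+ 2 +
           1 / d%:R * (1 - 1 / d%:R) *
             (d%:R * (1 - p) ^+ (2 * d - 1) - 1)^-1) < 1) :
  p <= p_shield R d.
Proof.
have d_gt1 : (1 < d)%N by lia.
have d0 : 0 < d%:R :> R by rewrite ltr0n; lia.
have [p0 p1] := andP hp.
set a := (1 / d%:R) `^ _ in h1.
have a0 : 0 <= a by exact: powR_ge0.
have aE : a ^+ (2 * d - 1) = d%:R^-1.
  rewrite -powR_mulrn // /a -powRrM natrB; last by lia.
  rewrite natrM !div1r mulVf ?powRr1 ?invr_ge0 ?ltW //.
  by rewrite subr_eq0 -natrM (eqr_nat R _ 1); lia.
have q0 : 0 < 1 - p by lra.
have qd : 0 < d%:R * (1 - p) ^+ (2 * d - 1) - 1.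
  rewrite subr_gt0 mulrC -ltr_pdivrMr // div1r -aE.
  have aq : a < 1 - p by lra.
  by rewrite ltrXn2r //; lia.
have sigma_lt1 : (1 - p)^-1 ^+ (2 * d - 1) / d%:R < 1.
  rewrite exprVn -invfM invf_lt1 ?mulr_gt0 ?exprn_gt0 //; lra.
have rho_lt1 : (1 - p)^-1 * (p2 P X X' - d%:R^-1 ^+ 2) +
    (1 - p)^-1 ^+ (2 * d) * (1 - d%:R^-1) /
      (d%:R ^+ 2 * (1 - (1 - p)^-1 ^+ (2 * d - 1) / d%:R)) < 1.
  apply: le_lt_trans h2; rewrite le_eqVlt; apply/orP; left; apply/eqP.
  have -> : (1 - p)^-1 ^+ (2 * d) = (1 - p)^-1 * ((1 - p) ^+ (2 * d - 1))^-1.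
    by rewrite -exprVn -exprS; congr (_ ^+ _); lia.
  rewrite [_^-1 ^+ (2 * d - 1)]exprVn; move: qd.
  move: ((1 - p) ^+ _) (lt0r_neq0 q0) => y q_neq0 qd.
  have y0 : y != 0.
    by apply: contraTneq qd => ->; rewrite mulr0 add0r oppr_gt0 ltr10.
  by field; rewrite q_neq0 y0 (lt0r_neq0 d0) !lt0r_neq0 // mulrC.
have r1 : 1 <= (1 - p)^-1 by rewrite invf_ge1 // gerBl.
have energyP n := (energy_le d_gt1 r1 (p2_ge d_gt1 hX)
  (avoid_le_p2 d_gt1 hX) sigma_lt1 rho_lt1 n).2.
have [Q hQ] := percolation_measure_exists hp d.
apply: ub_le_sup; first by exists 1 => x [/andP[]].
split=> //; exists Q; split=> //.
exact: (percolates hQ d_gt1 p0 q0 energyP).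
Qed.
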